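(* Let $d\ge 1$ and, for integers $N\ge 1$ and $n\in\mathbb Z$, let $$\Phi(N,n)=\begin{cases}\dfrac{(2N)!}{2^{2N}(N-n)!\,(N+n)!}&\text{if }|n|\le N,\\0&\text{if }|n|>N.\end{cases}$$ Let $\vartheta>0$ be arbitrary. Then there exists $K>0$ such that $\left|\sum_n\Phi(N,n)e^{2\pi i n t}\right|\le K\left(1+[\sqrt N]\,\|t\|\right)^{-\vartheta}$ for every integer $N\ge1$ and $t\in\mathbb R$, and consequently: (a) If $f\in W^{\delta,2}(\mathbb T^d)$, with $\delta>d/2$ if $0<\vartheta<1$ and $\delta>d\vartheta-d/2$ if $\vartheta\ge 1$, then for almost every $\alpha$ there exists $c(f,\alpha)>0$ such that $\sup_{x\in\mathbb T^d}|\mathcal D_N^{\Phi,\alpha}f(x)|\le c(f,\alpha)N^{-\frac{\vartheta}{2}}$ for every positive integer $N$. (b) If $\alpha\in\mathbb R^d$ is irrational and there exist $H>0$, $\sigma\ge d$ such that $\|\alpha\cdot m\|\ge H|m|^{-\sigma}$ for every $m\in\mathbb Z^d\setminus\{0\}$, and if $\delta>d/2$, then there exists $c>0$ such that $\sup_{x\in\mathbb T^d}|\mathcal D_N^{\Phi,\alpha}f(x)|\le cN^{-\frac{\vartheta}{2}}X(d,\delta,\vartheta,\sigma,[\sqrt N])\|f\|_{\delta,2}$ for every $f\in W^{\delta,2}(\mathbb T^d)$ and every positive integer $N$.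
   Context: $[\cdot]$ denotes the integer part. $\mathbb T^d=\mathbb R^d/\mathbb Z^d$; functions on $\mathbb T^d$ are identified with $\mathbb Z^d$-periodic functions on $\mathbb R^d$. For real $t$, $\|t\|=\inf_{n\in\mathbb Z}|t-n|$. A vector $\alpha=(\alpha_1,\dots,\alpha_d)\in\mathbb R^d$ is irrational if $1,\alpha_1,\dots,\alpha_d$ are linearly independent over $\mathbb Q$. Fourier coefficients: $\widehat f(m)=\int_{\mathbb T^d}f(x)e^{-2\pi i m\cdot x}dx$. For $\delta>0$, $W^{\delta,2}(\mathbb T^d)$ is the space of distributions on $\mathbb T^d$ with $\|f\|_{\delta,2}=\left(\sum_{m\in\mathbb Z^d}(1+|m|^2)^\delta|\widehat f(m)|^2\right)^{1/2}<\infty$; when $\delta>d/2$ its elements are identified with their continuous representatives. The weighted discrepancy is $\mathcal D_N^{\Phi,\alpha}f(x)=\sum_{n=-\infty}^{+\infty}\Phi(N,n)f(x+n\alpha)-\int_{\mathbb T^d}f(y)\,dy$. For a positive integer $M$, the quantity $X$ is $$X(d,\delta,\vartheta,\sigma,M)=\begin{cases} M^{\frac{-\delta+\vartheta\sigma-d\vartheta+d/2}{\sigma-d}} & \text{if }\vartheta<1/2,\ \delta<\vartheta\sigma-d(\vartheta-1/2),\\ \log^{1/2}(1+M) & \text{if }\vartheta<1/2,\ \delta=\vartheta\sigma-d(\vartheta-1/2),\\ 1 & \text{if }\vartheta<1/2,\ \delta>\vartheta\sigma-d(\vartheta-1/2),\\ M^{\frac{\sigma/2-\delta}{\sigma-d}}\log^{1/2}(1+M)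 & \text{if }\vartheta=1/2,\ \delta<\sigma/2,\\ \log(1+M) & \text{if }\vartheta=1/2,\ \delta=\sigma/2,\\ 1 & \text{if }\vartheta=1/2,\ \delta>\sigma/2,\\ M^{\frac{\vartheta(\vartheta\sigma-\delta)}{\vartheta\sigma-d/2}} & \text{if }\vartheta>1/2,\ \delta<\vartheta\sigma,\\ \log^{1/2}(1+M) & \text{if }\vartheta>1/2,\ \delta=\vartheta\sigma,\\ 1 & \text{if }\vartheta>1/2,\ \delta>\vartheta\sigma. \end{cases}$$ *)

(* Defs.v *)
From HB Require Import structures.
From mathcomp Require Import all_boot all_order all_algebra.
From mathcomp Require Import complex.
From mathcomp Require Import all_classical all_reals all_analysis.

Set Implicit Arguments.
Unset Strict Implicit.
Unset Printing Implicit Defensive.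

Import Order.TTheory GRing.Theory Num.Theory.
Import numFieldNormedType.Exports.

Local Open Scope classical_set_scope.
Local Open Scope complex_scope.
Local Open Scope ring_scope.

Section LebesgueTuple.
Variable R : realType.

(* The library has product measures on pairs only, and a product sigma-algebra
   but no measure on tuples. Lebesgue measure on R^n is built by recursion:
   the image of (lebesgue_measure \x lebesgue_tuple n) under (x, t) |-> x :: t. *)
Definition cons_pair n (p : measurableTypeR R * n.-tuple (measurableTypeR R)) :
  n.+1.-tuple (measurableTypeR R) := [the n.+1.-tuple _ of p.1 :: p.2].

Lemma measurable_cons_pair n : measurable_fun setT (@cons_pair n).
Proof. by apply: measurable_cons => //; exact: measurable_snd. Qed.

Definition uncons_pair n (t : n.+1.-tuple (measurableTypeR R)) :
  measurableTypeR R * n.-tuple (measurableTypeR R) :=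
  (thead t, [tuple of behead t]).

Lemma measurable_uncons_pair n : measurable_fun setT (@uncons_pair n).
Proof.
apply: (@measurable_fun_pair _ _ _ _ _ _ (fun t => thead t)
  (fun t => [tuple of behead t])); last exact: measurable_behead.
exact: measurable_tnth.
Qed.

Lemma cons_pairK n : cancel (@cons_pair n) (@uncons_pair n).
Proof.
by case=> x t; rewrite /uncons_pair /cons_pair /=; congr pair; apply: val_inj.
Qed.

Lemma sigma_finite_product d1 d2 (T1 : measurableType d1)
    (T2 : measurableType d2) (m1 : {sigma_finite_measure set T1 -> \bar R})
    (m2 : {sigma_finite_measure set T2 -> \bar R}) :
  sigma_finite setT (m1 \x m2)%E.
Proof.
have /sigma_finiteP[F [TF ndF Foo]] := sigma_finiteT m1.
have /sigma_finiteP[G [TG ndG Goo]] := sigma_finiteT m2.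
exists (fun n => F n `*` G n).
  rewrite -setXTT TF TG predeqE => -[x y]; split.
    move=> [/= [n _ Fnx] [k _ Gky]]; exists (maxn n k) => //; split.
    - by move: x Fnx; exact/subsetPset/ndF/leq_maxl.
    - by move: y Gky; exact/subsetPset/ndG/leq_maxr.
  by move=> [n _ []/= ? ?]; split; exists n.
move=> k; have [? ?] := Foo k; have [? ?] := Goo k.
split; first exact: measurableX.
by rewrite product_measure1E// lte_mul_pinfty// ge0_fin_numE.
Qed.

Section Step.
Variables (n : nat)
  (m : {sigma_finite_measure
          set (n.-tuple (measurableTypeR R)) -> \bar R}).

Definition lebesgue_tupleS : set (n.+1.-tuple (measurableTypeR R)) -> \bar R :=
  pushforward (@lebesgue_measure R \x m)%E (@cons_pair n).

Let lebesgue_tupleS0 : lebesgue_tupleS set0 = 0%E.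
Proof. by rewrite /lebesgue_tupleS /pushforward preimage_set0 measure0. Qed.

Let lebesgue_tupleS_ge0 A : (0 <= lebesgue_tupleS A)%E.
Proof.
exact: (@measure_ge0 _ _ _ (@lebesgue_measure R \x m)%E).
Qed.

Let lebesgue_tupleS_sigma_additive : semi_sigma_additive lebesgue_tupleS.
Proof.
apply: measure_semi_sigma_additive; exact: measurable_cons_pair.
Qed.

HB.instance Definition _ := isMeasure.Build _ _ _ lebesgue_tupleS
  lebesgue_tupleS0 lebesgue_tupleS_ge0 lebesgue_tupleS_sigma_additive.

Let lebesgue_tupleS_sigma_finite : sigma_finite setT lebesgue_tupleS.
Proof.
have [F FT mF] := sigma_finite_product (@lebesgue_measure R) m.
exists (fun k => @uncons_pair n @^-1` F k).
  by rewrite -preimage_bigcup -FT preimage_setT.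
move=> k; have [mFk Fkoo] := mF k; split.
  by rewrite -[X in measurable X]setTI; exact: measurable_uncons_pair.
rewrite /lebesgue_tupleS /pushforward -comp_preimage.
by rewrite (_ : _ \o _ = id) //; apply/funext => p; exact: cons_pairK.
Qed.

HB.instance Definition _ := Measure_isSigmaFinite.Build _ _ _ lebesgue_tupleS
  lebesgue_tupleS_sigma_finite.

End Step.

Fixpoint lebesgue_tuple n :
    {sigma_finite_measure set (n.-tuple (measurableTypeR R)) -> \bar R} :=
  match n with
  | 0 => \d_ [tuple]
  | n'.+1 => lebesgue_tupleS (lebesgue_tuple n')
  end.

End LebesgueTuple.

Section WeightedDiscrepancy.
Variable R : realType.

Definition row_of_tuple d (t : d.-tuple (measurableTypeR R)) : 'rV[R]_d :=
  \row_i tnth t i.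

Definition dotmz d (m : 'rV[int]_d) (x : 'rV[R]_d) : R :=
  \sum_(i < d) (m 0 i)%:~R * x 0 i.

Definition enormz d (m : 'rV[int]_d) : R :=
  Num.sqrt (\sum_(i < d) (m 0 i)%:~R ^+ 2).

Definition dist_int (t : R) : R := inf [set `|t - n%:~R| | n in [set: int]].

(* e^(2 pi i t) *)
Definition e2pi (t : R) : R[i] := cos (2 * pi * t) +i* sin (2 * pi * t).

Definition irrational_vec d (alpha : 'rV[R]_d) : Prop :=
  forall (q0 : rat) (q : 'I_d -> rat),
    ratr q0 + \sum_(i < d) ratr (q i) * alpha 0 i = 0 ->
    q0 = 0 /\ forall i, q i = 0.

Definition Zd_periodic d (f : 'rV[R]_d -> R[i]) : Prop :=
  forall (x : 'rV[R]_d) (z : 'rV[int]_d), f (x + map_mx intr z) = f x.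

Definition unit_cube d : set (d.-tuple (measurableTypeR R)) :=
  [set t | forall i, 0 <= tnth t i < 1].

(* Integral over T^d of a Z^d-periodic function, computed on the fundamental
   domain [0, 1)^d; the library only integrates real functions, whence the
   real and imaginary parts. *)
Definition torus_integral d (f : 'rV[R]_d -> R[i]) : R[i] :=
  (\int[lebesgue_tuple R d]_(t in @unit_cube d) complex.Re (f (row_of_tuple t)))
  +i* (\int[lebesgue_tuple R d]_(t in @unit_cube d) complex.Im (f (row_of_tuple t))).

Definition fourier_coef d (f : 'rV[R]_d -> R[i]) (m : 'rV[int]_d) : R[i] :=
  torus_integral (fun x => f x * e2pi (- dotmz m x)).

Definition sobolev_norm d (delta : R) (f : 'rV[R]_d -> R[i]) : \bar R :=
  ((\esum_(m in [set: 'rV[int]_d])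
      ((1 + enormz m ^+ 2) `^ delta *
       ComplexField.Normc.normc (fourier_coef f m) ^+ 2)%:E) `^ 2^-1)%E.

(* W^{delta,2}(T^d), each element being its continuous representative. This
   describes the whole space only when delta > d/2; it must not be used for
   smaller delta. R[i]^o carries the topology given by the complex modulus. *)
Definition sobolev d (delta : R) (f : 'rV[R]_d -> R[i]) : Prop :=
  [/\ continuous (f : 'rV[R]_d -> R[i]^o),
      Zd_periodic f
    & (sobolev_norm delta f < +oo)%E].

Definition sup_norm d (f : 'rV[R]_d -> R[i]) : \bar R :=
  ereal_sup [set (ComplexField.Normc.normc (f x))%:E | x in [set: 'rV[R]_d]].

(* (N - n)! and (N + n)! are written with absolute values, which are inert in
   the branch |n| <= N. *)
Definition Phi (N : nat) (n : int) : R :=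
  if (`|n| <= N)%N then
    ((2 * N)`!)%:R /
    (2 ^+ (2 * N) * ((absz (N%:Z - n)%R)`!)%:R * ((absz (N%:Z + n)%R)`!)%:R)
  else 0.

(* The sums over all n : int in the next two definitions are finitely supported
   sums (0 by convention on infinite supports): they are the intended sums
   because the weights W N n vanish for all but finitely many n, as for Phi. *)
Definition kernel_transform (W : nat -> int -> R) (N : nat) (t : R) : R[i] :=
  \sum_(n \in [set: int]) (W N n)%:C * e2pi (n%:~R * t).

Definition discrepancy d (W : nat -> int -> R) (N : nat) (alpha : 'rV[R]_d)
    (f : 'rV[R]_d -> R[i]) (x : 'rV[R]_d) : R[i] :=
  \sum_(n \in [set: int]) (W N n)%:C * f (x + n%:~R *: alpha)
  - torus_integral f.

Definition X (d : nat) (delta theta sigma : R) (M : nat) : R :=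
  let D : R := d%:R in
  let L : R := ln (1 + M%:R) in
  if theta < 2^-1 then
    let crit := theta * sigma - D * (theta - 2^-1) in
    if delta < crit then
      M%:R `^ ((- delta + theta * sigma - D * theta + D / 2) / (sigma - D))
    else if delta == crit then L `^ 2^-1
    else 1
  else if theta == 2^-1 then
    if delta < sigma / 2 then
      M%:R `^ ((sigma / 2 - delta) / (sigma - D)) * L `^ 2^-1
    else if delta == sigma / 2 then L
    else 1
  else
    if delta < theta * sigma then
      M%:R `^ (theta * (theta * sigma - delta) / (theta * sigma - D / 2))
    else if delta == theta * sigma then L `^ 2^-1
    else 1.

(* The integer part of the square root of N. *)
Definition isqrt (N : nat) : nat := Num.truncn (Num.sqrt (N%:R : R)).

End WeightedDiscrepancy.

(* Main.v *)
(* The binomial weights have Fourier transform cos(pi t)^(2N), which is at most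
   exp(-N ||t||^2), hence O((1 + [sqrt N] ||t||)^-theta) for every theta > 0.
   Averaging f against the positive trigonometric kernels
   prod_i cos(pi (x_i - y_i))^(2n) recovers f pointwise as n -> oo, so |D_N f| is at
   most the supremum, over finite sets S of nonzero frequencies, of
   sum_(m in S) |f^(m)| cos(pi m.alpha)^(2N).

   For (b), Cauchy-Schwarz leaves the sum of (1 + |m|^2)^-delta cos(pi m.alpha)^(4N).
   On the shell |m| ~ 2^j the Diophantine condition separates the numbers m.alpha by
   about 2^(-j sigma), so with M = [sqrt N] the cosines contribute at most
   M^-r 2^(j sigma r), for any r >= 1; beyond a threshold on j the cardinality 2^(jd)
   of the shell is used instead. The best r and threshold give X.

   For (a), choose p <= 1 with theta p < 1 and sum_m |f^(m)|^p finite. The mean of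
   cos(pi m.alpha)^(2n) over alpha is of order n^-1/2, so the series
   sum_k sum_m |f^(m)|^p 2^(k theta p / 2) cos(pi m.alpha)^(2 [2^k p]) has a finite
   integral over boxes, and its convergence at alpha yields the bound N^(-theta/2),
   first for N = 2^k and then for all N because the cosine powers decrease. *)
Require Import Defs.
From mathcomp Require Import all_boot all_order all_algebra.
From mathcomp Require Import complex finmap.
From mathcomp Require Import all_classical all_reals all_analysis.
From mathcomp Require Import measurable_realfun ring lra zify.
Set Implicit Arguments.
Unset Strict Implicit.
Import Order.TTheory GRing.Theory Num.Theory.
Import numFieldNormedType.Exports.
Import ComplexField.
Local Open Scope classical_set_scope.
Local Open Scope complex_scope.
Local Open Scope ring_scope.

(** * The binomial kernel *)

(** In (a) the mean of the kernel over alpha decays only like N^(-1/2), so first powers cannot give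
    N^(-theta/2) once theta >= 1. Passing to p-th powers turns the weight N^(theta/2) into N^(theta
    p/2) and keeps the order of the mean; along N = 2^k the products have size 2^(k (theta p -
    1)/2), which is summable because theta p < 1. The price is the summability of |f^(m)|^p, ensured
    by delta > d/p - d/2; as p increases to 1/theta this becomes the threshold d theta - d/2. In (b)
    the restriction r >= 1 comes from the separation: when M 2^(-j sigma) is small, about M^-1 2^(j
    sigma) points of a shell may lie within 1/M of the integers, and the r-th power of this number
    dominates it only for r >= 1. The squared bound asks for M^(-2 theta), that is r = 2 theta, so
    theta = 1/2 is the borderline in [X]. Sums over frequencies appear as bounds uniform over
    duplicate-free finite lists that avoid 0. *)

Section Kernel.
Variable R : realType.
Implicit Types (t u x y : R) (n m : int) (N k : nat).

Lemma has_inf_dist t : has_inf [set `|t - n%:~R| | n in [set: int]].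
Proof.
split; first by exists `|t - 0%:~R|; exists 0.
by exists 0 => _ [n _ <-].
Qed.

Lemma dist_int_le t n : dist_int t <= `|t - n%:~R|.
Proof. by apply: ge_inf; [case: (has_inf_dist t) | exists n]. Qed.

Lemma dist_int_ge0 t : 0 <= dist_int t.
Proof.
apply: lb_le_inf; first by case: (has_inf_dist t).
by move=> _ [n _ <-].
Qed.

Lemma dist_int_nearest t : exists n, dist_int t = `|t - n%:~R| /\ `|t - n%:~R| <= 2^-1.
Proof.
pose n := Num.floor (t + 2^-1); exists n.
have /andP[n1 n2] : n%:~R <= t + 2^-1 < (n + 1)%:~R by rewrite /n floor_le floorD1_gt.
have ht : `|t - n%:~R| <= 2^-1.
  by rewrite ler_norml; move: n1 n2; rewrite intrD; lra.
split=> //; apply/eqP; rewrite eq_le dist_int_le /=.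
apply: lb_le_inf; first by case: (has_inf_dist t).
move=> _ [m _ <-]; have [->//|mn] := eqVneq m n.
have h1 : (1 : R) <= `|(m - n)%:~R|.
  by rewrite -intr_norm (ler_int _ 1); move: mn; lia.
apply: (le_trans ht).
have := lerB_normD (m%:~R - n%:~R) (t - m%:~R).
rewrite (_ : m%:~R - n%:~R + (t - m%:~R) = t - n%:~R); last by ring.
move: h1; rewrite intrD mulrNz; lra.
Qed.

(** The mean value theorem gives z cos z <= sin z. At z = x/2 the double angle formula yields sin x
    >= x cos^2(x/2), and cos^2(x/2) = (1 + cos x)/2 >= 1/2. The constant 1/2 is good enough because
    pi/2 >= 1 is all that [sqr_dist_int_le_sin] asks for. *)
Lemma sin_ge_half x : 0 <= x <= pi / 2 -> x / 2 <= sin x.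
Proof.
move=> /andP[x0 xpi].
have zcosz (z : R) : 0 <= z <= pi / 2 -> z * cos z <= sin z.
  move=> /andP[]; rewrite le_eqVlt => /predU1P[<-|z0 zpi]; first by rewrite mul0r sin0.
  have [c /[!in_itv]/= /andP[c0 cz]] := @MVT R (@sin R) (@cos R) 0 z z0
    (fun x _ => is_derive_sin x) (continuous_subspaceT (@continuous_sin R)).
  rewrite sin0 !subr0 => ->; rewrite mulrC ler_pM2r//.
  have pi0 := @pi_gt0 R.
  by apply: ltW; rewrite ltr_cos ?in_itv /=; lra.
have pi0 := @pi_gt0 R.
have [cx sx] : 0 <= cos x /\ 0 <= cos (x / 2).
  by split; apply: cos_ge0_pihalf; lra.
have xE : x = (x / 2) *+ 2 by rewrite mulr2n; lra.
have h := zcosz (x / 2) ltac:(lra).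
rewrite xE sin_mulr2n -xE.
have : 2^-1 <= cos (x / 2) ^+ 2.
  by move: cx; rewrite {1}xE cos_mulr2n mulr2n; lra.
move: sx h; set c := cos _; set s := sin _ => sx h hc; rewrite -[leRHS]mulr_natl.
have := ler_wpM2l sx h; have := ler_wpM2l x0 hc; lra.
Qed.

Lemma e2piD x y : e2pi (x + y) = e2pi x * e2pi y.
Proof.
apply/eqP; rewrite /e2pi mulrDr cosD sinD eq_complex /=.
by apply/andP; split; apply/eqP; ring.
Qed.

Lemma e2pi0 : e2pi (0 : R) = 1.
Proof. by rewrite /e2pi mulr0 cos0 sin0. Qed.

Lemma e2pi_int n : e2pi (n%:~R : R) = 1.
Proof.
have h k : e2pi (k%:R : R) = 1.
  rewrite /e2pi mulrC (_ : k%:R * (2 * pi) = 0 + (pi *+ 2) *+ k); last first.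
    by rewrite add0r -[RHS]mulr_natl -[pi *+ 2]mulr_natl.
  by rewrite (periodicn (@cosD2pi R)) (periodicn (@sinD2pi R)) cos0 sin0.
case: n => k; first exact: h.
have := e2piD (k.+1%:R) (- k.+1%:R); rewrite subrr e2pi0 h mul1r => /esym.
by rewrite NegzE mulrNz.
Qed.

Lemma e2piX x k : e2pi x ^+ k = e2pi (k%:R * x).
Proof.
elim: k => [|k IH]; first by rewrite mul0r e2pi0 expr0.
by rewrite exprS IH -e2piD mulrS mulrDl mul1r.
Qed.

Lemma normc_e2pi x : ComplexField.Normc.normc (e2pi x) = 1.
Proof. by rewrite /e2pi /= cos2Dsin2 sqrtr1. Qed.

Lemma fsum_int (V : nmodType) N (F : int -> V) :
  (forall n, (N < `|n|)%N -> F n = 0) ->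
  \sum_(n \in [set: int]) F n = \sum_(k < (2 * N).+1) F (k%:Z - N%:Z).
Proof.
move=> F0; pose s := [seq k%:Z - N%:Z | k <- iota 0 (2 * N).+1].
have us : uniq s by rewrite map_inj_uniq ?iota_uniq// => a b /addIr [].
rewrite (fsbigTE [fset x in s]%fset) /=.
  rewrite (perm_big s) /=; last first.
    rewrite uniq_perm ?fset_uniq ?enum_finmem_uniq // => x.
    by apply/imfsetP/idP => [[y /= ys ->]//|xs]; exists x.
  by rewrite big_map -{1}[iota _ _]/(index_iota 0 (2 * N).+1) big_mkord.
move=> n; rewrite (_ : (n \in _) = (n \in s)); last first.
  by apply/imfsetP/idP => [[y /= ys ->]//|xs]; exists n.
move=> /negP ns; apply: F0.
rewrite ltnNge; apply/negP => nN; apply: ns.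
apply/mapP; exists (absz (n + N%:Z)); first by rewrite mem_iota; lia.
lia.
Qed.

Lemma Phi_out N n : (N < `|n|)%N -> Phi R N n = 0.
Proof. by rewrite /Phi ltnNge => /negbTE ->. Qed.

Lemma Phi_bin N k : (k <= 2 * N)%N ->
  Phi R N (k%:Z - N%:Z) = 'C(2 * N, k)%:R / 2 ^+ (2 * N).
Proof.
move=> kN; rewrite /Phi ifT; last by lia.
have -> : absz (N%:Z - (k%:Z - N%:Z))%R = (2 * N - k)%N by lia.
have -> : absz (N%:Z + (k%:Z - N%:Z))%R = k by lia.
rewrite -(bin_fact kN) !natrM.
have f0 j : j`!%:R != 0 :> R by rewrite pnatr_eq0 -lt0n fact_gt0.
have := f0 k; have := f0 (2 * N - k)%N.
have : (2 : R) ^+ (2 * N) != 0 by rewrite expf_neq0.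
move: (_ ^+ _) => w *; field; do ?split => //.
by apply/and3P; split.
Qed.

Lemma Phi_ge0 N n : 0 <= Phi R N n.
Proof. by rewrite /Phi; case: ifP. Qed.

(** The binomial theorem applied to cos(pi t) = (e2pi(-t/2) + e2pi(t/2))/2; the even exponent turns
    the half-integer frequencies into integers. *)
Lemma cos_pow_sum N t : ((cos (pi * t) ^+ (2 * N))%:C : R[i]) =
  \sum_(k < (2 * N).+1) (Phi R N (k%:Z - N%:Z))%:C * e2pi ((k%:Z - N%:Z)%:~R * t).
Proof.
have E : ((cos (pi * t) : R)%:C : R[i]) = (2^-1)%:C * (e2pi (- (t / 2)) + e2pi (t / 2)).
  rewrite /e2pi mulrN cosN sinN (_ : 2 * pi * (t / 2) = pi * t); last by field.
  by apply/eqP; rewrite eq_complex /=; apply/andP; split; apply/eqP; field.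
rewrite rmorphXn /= E exprMn exprDn mulr_sumr; apply: eq_bigr => -[k /= kN] _.
rewrite Phi_bin // -rmorphXn /= !e2piX -e2piD -[X in _ * X]mulr_natr.
rewrite (_ : (2 * N - k)%:R * - (t / 2) + k%:R * (t / 2) = (k%:Z - N%:Z)%:~R * t); last first.
  by rewrite natrB // natrM intrB /=; field.
rewrite mulrA mulrAC; congr (_ * _).
by rewrite exprVn -(rmorph_nat (@real_complex R)) -rmorphM mulrC.
Qed.

Lemma kernel_Phi N t : kernel_transform (@Phi R) N t = (cos (pi * t) ^+ (2 * N))%:C.
Proof.
rewrite cos_pow_sum /kernel_transform (@fsum_int _ N)// => n nN.
by rewrite Phi_out// mul0r.
Qed.

Lemma sqr_cos_pi_int n t : cos (pi * (t - n%:~R)) ^+ 2 = cos (pi * t) ^+ 2.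
Proof.
have h x : cos (pi * x) ^+ 2 = (complex.Re (e2pi x) + 1) / 2.
  by rewrite /e2pi /= -mulrA mulr_natl cos_mulr2n mulr2n; field.
by rewrite !h e2piD -mulrNz e2pi_int mulr1.
Qed.

Lemma sqr_dist_int_le_sin t : dist_int t ^+ 2 <= sin (pi * t) ^+ 2.
Proof.
have [n [-> tn]] := dist_int_nearest t.
have sE x : sin (pi * x) ^+ 2 = 1 - cos (pi * x) ^+ 2.
  by rewrite -(cos2Dsin2 (pi * x)) addrAC subrr add0r.
rewrite sE -(sqr_cos_pi_int n); move: (t - _) tn => u hu.
have pi2 := @pi_ge2 R.
have pu : 0 <= pi * `|u| <= pi / 2 by rewrite mulr_ge0 ?(le_trans _ pi2)//= ler_pM2l //; exact: pi_gt0.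
have hs := sin_ge_half pu.
have -> : cos (pi * u) = cos (pi * `|u|).
  by rewrite -[RHS]cos_norm -[LHS]cos_norm !normrM normr_id.
rewrite -sE lerXn2r ?nnegrE//.
  by apply: le_trans hs; lra.
apply: le_trans hs; have := normr_ge0 u; nra.
Qed.

Lemma sqr_cos_le t : cos (pi * t) ^+ 2 <= expR (- dist_int t ^+ 2).
Proof.
apply: le_trans (expR_ge1Dx _); have := sqr_dist_int_le_sin t.
by have := cos2Dsin2 (pi * t); lra.
Qed.

Lemma isqrt_le N : (isqrt R N)%:R <= Num.sqrt (N%:R : R).
Proof. by rewrite /isqrt truncn_le// sqrtr_ge0. Qed.

Lemma isqrt_sq N : ((isqrt R N)%:R : R) ^+ 2 <= N%:R.
Proof.
have /lerXn2r := isqrt_le N => /(_ 2%N); rewrite !nnegrE sqrtr_ge0 ler0n sqr_sqrtr ?ler0n//.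
exact.
Qed.

Lemma isqrt_gt0 N : (0 < N)%N -> (0 < isqrt R N)%N.
Proof.
move=> N0; rewrite /isqrt truncn_gt0 -[leLHS]sqrtr1 ler_sqrt ?ltr0n//.
by rewrite ler1n.
Qed.

Lemma sqrt_le_isqrt N : (0 < N)%N -> Num.sqrt (N%:R : R) <= 2 * (isqrt R N)%:R.
Proof.
move=> N0; have := isqrt_gt0 N0; rewrite -(ler1n R).
have := @truncnS_gt R (Num.sqrt N%:R).
by rewrite -/(isqrt R N) -natr1; lra.
Qed.

(** With x = [sqrt N] ||t|| and [sqrt N]^2 <= N, it is enough to compare exp(-x^2) with (1 +
    x)^-theta. The constant is a completed square: theta ln(1 + x) <= theta x <= x^2 + theta^2/4. *)
Lemma cos_pow_le (theta : R) N t : 0 < theta ->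
  cos (pi * t) ^+ (2 * N) <=
  expR (theta ^+ 2 / 4) * (1 + (isqrt R N)%:R * dist_int t) `^ (- theta).
Proof.
move=> th; rewrite exprM.
have d0 := dist_int_ge0 t; set d := dist_int t in d0 *.
have M0 : 0 <= (isqrt R N)%:R :> R by rewrite ler0n.
have x0 : 0 <= (isqrt R N)%:R * d by rewrite mulr_ge0.
set x := _ * d in x0 *.
apply: (@le_trans _ _ (expR (- x ^+ 2))).
  apply: (@le_trans _ _ (expR (- d ^+ 2) ^+ N)).
    by apply: lerXn2r; rewrite ?nnegrE ?sqr_ge0 ?expR_ge0 ?sqr_cos_le.
  rewrite -expRM_natl ler_expR mulrN lerN2 /x exprMn.
  by rewrite ler_wpM2r ?sqr_ge0 ?isqrt_sq.
rewrite /powR ifF ?gt_eqF//; last by lra.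
rewrite -expRD ler_expR.
have := @le_ln1Dx R x; rewrite (lt_le_trans _ x0) // => /(_ isT).
have : 0 <= (x - theta / 2) ^+ 2 by rewrite sqr_ge0.
nra.
Qed.

End Kernel.

(** * The central coefficient Phi(N, 0) and its decay *)

Section CentralCoefficient.
Variable R : realType.

Lemma Phi00 : Phi R 0 0 = 1.
Proof. by rewrite (@Phi_bin R 0 0)// bin0 expr0 divr1. Qed.

Lemma Phi0_bin N : Phi R N 0 = 'C(2 * N, N)%:R / 2 ^+ (2 * N).
Proof. by rewrite -[X in Phi _ _ X](subrr N%:Z) Phi_bin //; lia. Qed.

Lemma Phi0_gt0 N : 0 < Phi R N 0.
Proof. by rewrite Phi0_bin divr_gt0 ?exprn_gt0// ltr0n bin_gt0; lia. Qed.

(** This is also Wallis's recurrence for the mean of cos^(2N), which is how Phi(N, 0) enters the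
    integrals below. *)
Lemma Phi0S N : (2 * N%:R + 2) * Phi R N.+1 0 = (2 * N%:R + 1) * Phi R N 0.
Proof.
rewrite !Phi0_bin.
have b1 : (N.+1 * 'C(2 * N.+1, N.+1) = (2 * N.+1) * 'C((2 * N).+1, N))%N.
  by rewrite (_ : (2 * N.+1 = (2 * N).+2)%N) ?mul_bin_diag //; lia.
have b2 : (N.+1 * 'C((2 * N).+1, N) = (2 * N).+1 * 'C(2 * N, N))%N.
  have := mul_bin_down (2 * N).+1 N; rewrite (_ : ((2 * N).+1 - N = N.+1)%N); last by lia.
  by move=> ->.
have b : (N.+1 * 'C(2 * N.+1, N.+1) = 2 * ((2 * N).+1 * 'C(2 * N, N)))%N.
  by move: b1 b2; nia.
have {b} := congr1 (fun k => k%:R : R) b; rewrite !natrM -(natr1 N) -(natr1 (2 * N)) natrM => b.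
rewrite (_ : (2 * N.+1 = (2 * N).+2)%N) in b *; last by lia.
have -> : (2 : R) ^+ (2 * N).+2 = 4 * 2 ^+ (2 * N) by rewrite !exprS; ring.
have w0 : (2 : R) ^+ (2 * N) != 0 by rewrite expf_neq0.
move: b w0; move: (2 ^+ _) => w b w0.
apply: (@mulfI _ w) => //; rewrite !mulrA.
transitivity (((N%:R + 1) * 'C((2 * N).+2, N.+1)%:R) / 2 : R); first by field.
by rewrite b; field.
Qed.

(** An elementary form of the decay N^(-1/2), without Stirling: the left side is nonincreasing in N,
    by the recurrence. *)
Lemma sqr_Phi0_le N : Phi R N 0 ^+ 2 * (N%:R + 1) <= 1.
Proof.
elim: N => [|N IH]; first by rewrite Phi00; lra.
have := Phi0S N; have := Phi0_gt0 N.+1; have := Phi0_gt0 N; rewrite -(natr1 N).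
have N0 : 0 <= N%:R :> R by [].
move: N%:R N0 IH => n n0; move: (Phi R N 0) (Phi R N.+1 0) => a b IH a0 b0 E.
have -> : b = (2 * n + 1) * a / (2 * n + 2) by rewrite -E mulrC mulKf//; lra.
apply: le_trans IH; rewrite -subr_ge0.
rewrite (_ : _ - _ = a ^+ 2 * (3 * n + 2) / (2 * n + 2) ^+ 2); last by field; lra.
by rewrite !mulr_ge0 ?sqr_ge0 ?invr_ge0 ?sqr_ge0//; lra.
Qed.

End CentralCoefficient.

(** * Integrals over boxes *)

Section BoxIntegral.
Variable R : realType.
Notation mR := (measurableTypeR R).
Local Notation mu := (@lebesgue_measure R).

Definition box (a b : R) d : set (d.-tuple mR) := [set t | forall i, a <= tnth t i < b].
Arguments box : clear implicits.

Lemma unit_cubeE d : @unit_cube R d = box 0 1 d.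
Proof. by []. Qed.

Lemma measurable_box a b d : measurable (box a b d).
Proof.
have -> : box a b d = \bigcap_(i in [set: 'I_d]) ((fun t : d.-tuple mR => tnth t i) @^-1` `[a, b[%classic).
  apply/seteqP; split=> t /= h i; first by rewrite /= in_itv /=.
  by have := h i I; rewrite /= in_itv.
apply: fin_bigcap_measurable; first exact: finite_finset.
move=> i _; rewrite -[X in measurable X]setTI.
by apply: measurable_tnth => //; exact: measurable_itv.
Qed.

Lemma cons_box a b d (x : R) (t : d.-tuple mR) :
  box a b d.+1 (cons_pair (x, t)) <-> (a <= x < b) /\ box a b d t.
Proof.
rewrite /box /cons_pair /=; split=> [h|[hx ht] i].
  split; first by have := h ord0; rewrite tnth0.
  by move=> i; have := h (lift ord0 i); rewrite tnthS.
by have [j ->|->] := unliftP ord0 i; rewrite ?tnthS ?tnth0.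
Qed.

(** Tonelli's theorem transported along the pushforward that defines [lebesgue_tuple]. *)
Lemma integral_boxS a b d (F : d.+1.-tuple mR -> \bar R) :
  measurable_fun [set: d.+1.-tuple mR] F -> (forall t, 0 <= F t)%E ->
  (\int[lebesgue_tuple R d.+1]_(t in box a b d.+1) F t =
   \int[mu]_(x in `[a, b[) \int[lebesgue_tuple R d]_(t in box a b d) F (cons_pair (x, t)))%E.
Proof.
move=> mF F0.
have mc := @measurable_cons_pair R d.
have mD : measurable (@cons_pair R d @^-1` box a b d.+1).
  by rewrite -[X in measurable X]setTI; apply: mc => //; exact: measurable_box.
rewrite [LHS](ge0_integral_pushforward mc (mu \x lebesgue_tuple R d)%E) //; last 2 first.
- exact: measurable_box.
- exact: measurable_funTS.
rewrite integral_mkcond fubini_tonelli1 /=; last 2 first.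
- apply/(measurable_restrictT _ _).1 => //; apply: measurable_funTS.
  exact: measurableT_comp.
- by move=> p; rewrite /patch; case: ifP => // _; exact: F0.
rewrite [RHS]integral_mkcond; apply: eq_integral => x _.
rewrite /fubini_F /patch mem_setE in_itv /=.
case: ifPn => xab.
  rewrite [RHS]integral_mkcond; apply: eq_integral => t _.
  rewrite /patch; congr (if _ then _ else _).
  apply/idP/idP; rewrite !inE /= => h; first by have [] := (cons_box a b x t).1 h.
  exact/cons_box.
rewrite integral0_eq// => t _.
by rewrite ifF//; apply/negbTE/negP; rewrite inE /= => /cons_box[h _]; rewrite h in xab.
Qed.

Lemma integral_box0 a b (F : 0.-tuple mR -> \bar R) : (forall t, 0 <= F t)%E ->
  (\int[lebesgue_tuple R 0]_(t in box a b 0) F t = F [tuple])%E.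
Proof.
move=> F0; rewrite (_ : box a b 0 = setT); last by apply/seteqP; split=> // t _ [].
rewrite (_ : F = cst (F [tuple])); last by apply/funext => t; rewrite tuple0.
by rewrite integral_cst // /= diracT mule1.
Qed.

Lemma measurable_tnthR d (i : 'I_d) : measurable_fun setT (fun t : d.-tuple mR => tnth t i : R).
Proof. exact: measurable_tnth. Qed.

Lemma integral_box_prod a b d (h : 'I_d -> R -> R) (c : 'I_d -> R) :
  (forall i, measurable_fun setT (h i)) -> (forall i x, 0 <= h i x) ->
  (forall i, \int[mu]_(x in `[a, b[) (h i x)%:E = (c i)%:E)%E ->
  (\int[lebesgue_tuple R d]_(t in box a b d) (\prod_(i < d) h i (tnth t i))%:E =
   (\prod_(i < d) c i)%:E)%E.
Proof.
elim: d h c => [|d IH] h c mh h0 hc.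
  by rewrite integral_box0 ?big_ord0// => t; rewrite lee_fin prodr_ge0.
rewrite integral_boxS; last 2 first.
- apply/measurable_EFinP; apply: measurable_prod => i _.
  exact: measurableT_comp (mh i) (measurable_tnthR i).
- by move=> t; rewrite lee_fin prodr_ge0.
pose C := \prod_(i < d) c (lift ord0 i).
transitivity (\int[mu]_(x in `[a, b[) (C%:E * (h ord0 x)%:E))%E.
  apply: eq_integral => x _.
  transitivity (\int[lebesgue_tuple R d]_(t in box a b d)
      ((h ord0 x)%:E * (\prod_(i < d) h (lift ord0 i) (tnth t i))%:E))%E.
    apply: eq_integral => t _; rewrite big_ord_recl tnth0 EFinM.
    by under eq_bigr => i _ do rewrite tnthS.
  rewrite ge0_integralZl_EFin//.
  - by rewrite (IH (fun i => h (lift ord0 i)) (fun i => c (lift ord0 i))) // muleC.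
  - exact: measurable_box.
  - by move=> t _; rewrite lee_fin prodr_ge0.
  - apply: measurable_funTS; apply/measurable_EFinP; apply: measurable_prod => i _.
    exact: measurableT_comp (mh _) (measurable_tnthR i).
rewrite ge0_integralZl_EFin//.
- by rewrite hc big_ord_recl -EFinM mulrC.
- by move=> x _; rewrite lee_fin.
- by apply: measurable_funTS; apply/measurable_EFinP; exact: (mh ord0).
- apply: prodr_ge0 => i _; rewrite -lee_fin -hc.
  by apply: integral_ge0 => x _; rewrite lee_fin.
Qed.

End BoxIntegral.
Arguments box {R} a b d _.

(** * Mean values of even powers of cosines *)

Section CosPowIntegral.
Variable R : realType.
Local Notation mu := (@lebesgue_measure R).

(** The antiderivative of cos^(2N)(pi (m x + c)) given by the classical reduction formula, obtained
    by integrating by parts. *)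
Fixpoint cos_pow_prim (m c : R) (N : nat) (x : R) : R :=
  if N is N'.+1 then
    ((2 * N'%:R + 1) * cos_pow_prim m c N' x +
     sin (pi * (m * x + c)) * cos (pi * (m * x + c)) ^+ (2 * N').+1 / (pi * m)) / (2 * N'%:R + 2)
  else x.

Lemma is_derive_cos_pow_prim (m c : R) N (x : R) : m != 0 ->
  is_derive x 1 (cos_pow_prim m c N) (cos (pi * (m * x + c)) ^+ (2 * N)).
Proof.
move=> m0; have pi0 : pi != 0 :> R by rewrite gt_eqF// pi_gt0.
elim: N => [|N IH] /=; first by rewrite muln0 expr0; exact: is_derive_id.
have hu : is_derive x 1 (fun x => pi * (m * x + c)) (pi * m).
  by apply: is_derive_eq; rewrite /GRing.scale /= ; ring.
set u := pi * (m * x + c).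
have hs : is_derive x 1 (fun x => sin (pi * (m * x + c))) (cos u * (pi * m)).
  exact: (@is_derive1_comp _ (@sin R) _ x _ _ (is_derive_sin _) hu).
have hc : is_derive x 1 (fun x => cos (pi * (m * x + c))) (- sin u * (pi * m)).
  exact: (@is_derive1_comp _ (@cos R) _ x _ _ (is_derive_cos _) hu).
have hp := is_deriveX (2 * N).+1 hc; rewrite exprfctE in hp.
have h := is_deriveM hs hp.
have h1 := @is_deriveZ _ _ _ _ (pi * m)^-1 _ _ _ h.
have h2 := @is_deriveZ _ _ _ _ (2 * N%:R + 1 : R) _ _ _ IH.
have h3 := @is_deriveZ _ _ _ _ (2 * N%:R + 2 : R)^-1 _ _ _ (is_deriveD h2 h1).
rewrite (_ : (fun x0 => _) = (2 * N%:R + 2)^-1 *: ((2 * N%:R + 1) *: cos_pow_prim m c N +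
   (pi * m)^-1 *: ((fun x => sin (pi * (m * x + c))) * (fun x => cos (pi * (m * x + c)) ^+ (2 * N).+1)))); last first.
  by apply/funext => y; rewrite /= mulrC; congr (_ * (_ + _)); rewrite mulrC.
apply: is_derive_eq h3 _; rewrite /GRing.scale /= -/u.
have -> : (2 * N.+1 = (2 * N).+2)%N by lia.
have N0 : 2 * N%:R + 2 != 0 :> R by rewrite gt_eqF// ltr_wpDl ?mulr_ge0.
rewrite -(natr1 (2 * N)) natrM !exprS; have := cos2Dsin2 u; rewrite !expr2.
move: (cos u) (sin u) (cos u ^+ _) => C S P E.
have SE : S * S = 1 - C * C by rewrite -E addrAC subrr add0r.
transitivity (((2 * N%:R + 1) * P * (1 - S * S) + C * P * C) / (2 * N%:R + 2)).
  clear -m0 N0 pi0 E; move: (@pi R) pi0 => p p0.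
  by field; apply/and3P; split.
by rewrite SE; field.
Qed.

Lemma continuous_cos_pow (m c : R) k : continuous (fun x => cos (pi * (m * x + c)) ^+ k).
Proof.
move=> x; apply: (@continuous_comp _ _ _ (fun x => cos (pi * (m * x + c))) (fun y : R => y ^+ k)); last exact: exprn_continuous.
apply: (@continuous_comp _ _ _ (fun x => pi * (m * x + c)) (@cos R)); last exact: continuous_cos.
apply: cvgM; first exact: cvg_cst.
by apply: cvgD; [apply: cvgM; [exact: cvg_cst | exact: cvg_id] | exact: cvg_cst].
Qed.

(** The boundary term sin z cos^(2N+1) z equals sin(2z)/2 times a power of cos^2 z. It has period pi
    in z, so it takes the same value at 0 and at the integer a and cancels. What remains is the
    recurrence of [Phi0S]. *)
Lemma cos_pow_prim_int (m : int) (c : R) N (a : int) :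
  cos_pow_prim m%:~R c N a%:~R - cos_pow_prim m%:~R c N 0 = Phi R N 0 * a%:~R.
Proof.
elim: N => [|N IH] /=; first by rewrite Phi00 subr0 mul1r.
have N0 : 2 * N%:R + 2 != 0 :> R by rewrite gt_eqF// ltr_wpDl ?mulr_ge0.
have -> : Phi R N.+1 0 = (2 * N%:R + 1) * Phi R N 0 / (2 * N%:R + 2).
  by rewrite -Phi0S mulrC mulKf.
set u := pi * (_ + c); set v := pi * (_ + c).
have h (z : R) : sin z * cos z ^+ (2 * N).+1 = (sin (z *+ 2) / 2) * (cos z ^+ 2) ^+ N.
  by rewrite sin_mulr2n exprS exprM -[_ *+ 2]mulr_natl; field.
have -> : sin u * cos u ^+ (2 * N).+1 = sin v * cos v ^+ (2 * N).+1.
  rewrite !h; congr (_ / _ * _ ^+ _).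
    have -> : u *+ 2 = 2 * pi * c + 2 * pi * (m * a)%:~R by rewrite /u intrM -mulr_natl; ring.
    rewrite sinD.
    have /eqP := e2pi_int R (m * a); rewrite eq_complex /= => /andP[/eqP -> /eqP ->].
    by rewrite mulr1 mulr0 addr0; congr sin; rewrite /v mulr0 add0r -[RHS]mulr_natl mulrA.
  rewrite (_ : u = pi * (c - (- (m * a))%:~R)); last by rewrite /u mulrNz opprK intrM addrC.
  by rewrite sqr_cos_pi_int /v mulr0 add0r.
move: IH; move: (cos_pow_prim _ _ _ a%:~R) (cos_pow_prim _ _ _ 0) => p q E.
rewrite -mulrBl -mulrA [RHS]mulrAC; congr (_ / _).
by rewrite opprD addrACA subrr addr0 -mulrBr E mulrA.
Qed.

Lemma integral_cos_pow (m : int) (c : R) N (a b : int) : m != 0 -> a < b ->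
  (\int[mu]_(x in `[a%:~R, b%:~R[) (cos (pi * (m%:~R * x + c)) ^+ (2 * N))%:E =
   (Phi R N 0 * (b - a)%:~R)%:E)%E.
Proof.
move=> m0 ab; have m0' : m%:~R != 0 :> R by rewrite intr_eq0.
rewrite integral_itv_bndo_bndc; last first.
  apply: measurable_funTS; apply/measurable_EFinP; apply: continuous_measurable_fun.
  exact: continuous_cos_pow.
have dF x := @is_derive_cos_pow_prim m%:~R c N x m0'.
rewrite (@continuous_FTC2 _ _ (cos_pow_prim m%:~R c N)).
- rewrite -EFinB; congr (_%:E).
  by rewrite intrB mulrBr -!(cos_pow_prim_int m c); ring.
- by rewrite ltr_int.
- by apply: continuous_subspaceT; exact: continuous_cos_pow.
- have cF x : {for x, continuous (cos_pow_prim m%:~R c N)}.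
    by apply: differentiable_continuous; apply/derivable1_diffP; case: (dF x).
  split; first by move=> x _; case: (dF x).
  + by apply: cvg_at_right_filter; exact: cF.
  + by apply: cvg_at_left_filter; exact: cF.
- by move=> x _; rewrite derive1E; apply: derive_val.
Qed.

Notation mR := (measurableTypeR R).

Lemma lebesgue_tuple_box d (a b : R) : a < b ->
  lebesgue_tuple R d (box a b d) = ((b - a) ^+ d)%:E.
Proof.
move=> ab.
have h := @integral_box_prod R a b d (fun _ _ => 1) (fun=> b - a).
transitivity ((\prod_(i < d) (b - a))%:E); last by rewrite prodr_const card_ord.
rewrite -h // => [|i].
  rewrite (eq_integral (cst 1%E)) ?integral_cst ?mul1e //; first exact: measurable_box.
  by move=> t _; rewrite big1.
rewrite (eq_integral (cst 1%E)) // integral_cst // mul1e /=.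
by rewrite lebesgue_measure_itv /= lte_fin ab EFinB.
Qed.

Lemma measurable_linear_form d (m : 'I_d -> R) (c : R) :
  measurable_fun [set: d.-tuple mR] (fun t => \sum_(i < d) m i * tnth t i + c).
Proof.
apply: measurable_funD => //; apply: measurable_sum => i.
by apply: measurable_funM => //; exact: measurable_tnthR.
Qed.

Lemma measurable_cos_pow_form d (m : 'I_d -> R) (c : R) k :
  measurable_fun [set: d.-tuple mR]
    (fun t => cos (pi * (\sum_(i < d) m i * tnth t i + c)) ^+ k).
Proof.
apply: measurable_funX; apply: measurableT_comp.
  by apply: continuous_measurable_fun; exact: continuous_cos.
by apply: measurable_funM => //; exact: measurable_linear_form.
Qed.

Lemma cos_pow_ge0 N (x : R) : 0 <= cos x ^+ (2 * N).
Proof. by rewrite exprM exprn_ge0 // sqr_ge0. Qed.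

(** The mean depends neither on the nonzero frequency m nor on the phase c. The phase is what makes
    the induction on d work: if m has a nonzero entry beyond the first, the first coordinate is
    absorbed into c; otherwise the integrand depends on the first coordinate alone. *)
Lemma integral_box_cos_pow d (m : 'I_d -> int) (c : R) N (a b : int) :
  (exists i, m i != 0) -> a < b ->
  (\int[lebesgue_tuple R d]_(t in box a%:~R b%:~R d)
     (cos (pi * (\sum_(i < d) (m i)%:~R * tnth t i + c)) ^+ (2 * N))%:E =
   (Phi R N 0 * (b - a)%:~R ^+ d)%:E)%E.
Proof.
move=> + ab; have ab' : a%:~R < b%:~R :> R by rewrite ltr_int.
have P0 := ltW (Phi0_gt0 R N).
have ab0 : 0 <= (b - a)%:~R :> R by rewrite ler0z subr_ge0 ltW.
elim: d m c => [|d IH] m c [i0 mi0]; first by case: i0 mi0.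
rewrite integral_boxS; last 2 first.
- apply/measurable_EFinP; exact: (measurable_cos_pow_form (fun i => (m i)%:~R)).
- by move=> t; rewrite lee_fin cos_pow_ge0.
pose m' i := m (lift ord0 i).
have E (x : R) (t : d.-tuple mR) :
    \sum_(i < d.+1) (m i)%:~R * tnth (cons_pair (x, t)) i + c =
    \sum_(i < d) (m' i)%:~R * tnth t i + ((m ord0)%:~R * x + c).
  rewrite big_ord_recl tnth0 addrA; congr (_ + _); rewrite addrC; congr (_ + _).
  by apply: eq_bigr => i _; rewrite tnthS.
have [[i mi]|m'0] := pselect (exists i, m' i != 0).
  transitivity (\int[mu]_(x in `[a%:~R, b%:~R[) (Phi R N 0 * (b - a)%:~R ^+ d)%:E)%E.
    apply: eq_integral => x _; under eq_integral => t _ do rewrite E.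
    by rewrite IH //; exists i.
  rewrite integral_cst //= lebesgue_measure_itv /= lte_fin ab' -EFinB -EFinM.
  by rewrite exprSr intrB mulrA.
have m0 : m ord0 != 0.
  apply: contra_notN m'0 => /eqP m0; case: (unliftP ord0 i0) => [j ij|i00].
    by exists j; rewrite /m' -ij.
  by move: mi0; rewrite i00 m0 eqxx.
transitivity (\int[mu]_(x in `[a%:~R, b%:~R[)
   (((b - a)%:~R ^+ d)%:E * (cos (pi * ((m ord0)%:~R * x + c)) ^+ (2 * N))%:E))%E.
  apply: eq_integral => x _.
  transitivity (\int[lebesgue_tuple R d]_(t in box a%:~R b%:~R d)
     (cos (pi * ((m ord0)%:~R * x + c)) ^+ (2 * N))%:E)%E.
    apply: eq_integral => t _; rewrite E big1 ?add0r// => i _.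
    have [->|mi] := eqVneq (m' i) 0; first by rewrite mul0r.
    by exfalso; apply: m'0; exists i.
  rewrite integral_cst /=; last exact: measurable_box.
  by rewrite lebesgue_tuple_box // muleC intrB.
rewrite ge0_integralZl_EFin//.
- by rewrite [X in (_ * X)%E]integral_cos_pow // -EFinM; congr (_%:E); rewrite exprS; ring.
- by move=> x _; rewrite lee_fin cos_pow_ge0.
- apply: measurable_funTS; apply/measurable_EFinP; apply: continuous_measurable_fun.
  exact: continuous_cos_pow.
- by rewrite exprn_ge0.
Qed.

End CosPowIntegral.

(** * Pointwise approximation by positive trigonometric kernels *)

Section Korovkin.
Variables (R : realType) (d : nat).
Notation mR := (measurableTypeR R).
Local Notation mu := (@lebesgue_measure R).
Local Notation mud := (lebesgue_tuple R d).
Local Notation row := (@row_of_tuple R d).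
Implicit Types (x y : 'rV[R]_d) (g : 'rV[R]_d -> R).

Lemma measurable_step (C : countType) (phi : d.-tuple mR -> C) (G : C -> R) :
  (forall c, measurable (phi @^-1` [set c])) ->
  measurable_fun setT (G \o phi).
Proof.
move=> mphi _ A mA; rewrite setTI.
have -> : (G \o phi) @^-1` A = \bigcup_(c in setT) (if `[<A (G c)>] then phi @^-1` [set c] else set0).
  apply/seteqP; split=> [t At|t [c _]].
    by exists (phi t) => //; rewrite asboolT.
  by case: asboolP => // Ac /= tc; rewrite tc.
apply: countable_bigcupT_measurable; first exact: countableP.
by move=> c; case: ifP.
Qed.

Lemma row_dist_lt x y (e : R) : 0 < e -> (forall i, `|x 0 i - y 0 i| < e) -> `|x - y| < e.
Proof.
move=> e0 h; rewrite [ltLHS]/Num.norm /= mx_normrE.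
by apply/bigmax_ltP; split=> // -[i j] _; rewrite !mxE (ord1 i).
Qed.

(** Measurability refers to the product sigma-algebra on tuples, so continuity is used through a
    pointwise limit: g is the limit of its values at the corner of the grid cell of side 1/(k+1)
    containing the point, and there are countably many cells. *)
Lemma measurable_continuous_row g : continuous g ->
  measurable_fun [set: d.-tuple mR] (g \o row).
Proof.
move=> cg.
pose phi k (t : d.-tuple mR) : 'rV[int]_d := \row_i Num.floor (k.+1%:R * (tnth t i : R)).
pose G k (z : 'rV[int]_d) : R := g (\row_i ((z 0 i)%:~R / k.+1%:R)).
apply: (@measurable_fun_cvg _ _ _ _ (fun k => G k \o phi k)) => [k|t _].
  apply: measurable_step => c.
  have -> : phi k @^-1` [set c] = \bigcap_(i in [set: 'I_d])
      ((fun t : d.-tuple mR => tnth t i) @^-1` `[(c 0 i)%:~R / k.+1%:R, (c 0 i + 1)%:~R / k.+1%:R[%classic).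
    apply/seteqP; split=> t /=.
      move=> tc i _ /=; rewrite in_itv /= ler_pdivrMr// ltr_pdivlMr// mulrC -tc mxE.
      by rewrite floor_le floorD1_gt.
    move=> h; apply/rowP => i; rewrite mxE; apply: floor_def.
    have := h i Logic.I; rewrite /= in_itv /= ler_pdivrMr// ltr_pdivlMr// mulrC.
    by [].
  apply: fin_bigcap_measurable; first exact: finite_finset.
  move=> i _; rewrite -[X in measurable X]setTI.
  by apply: measurable_tnth => //; exact: measurable_itv.
apply: (cvg_comp (fun k => \row_i ((phi k t 0 i)%:~R / k.+1%:R)) g _ (cg (row t))).
apply/cvgrPdist_lt => e e0; near=> k.
apply: row_dist_lt => // i; rewrite !mxE.
set a := tnth t i.
have k0 : 0 < k.+1%:R :> R by [].
have h1 := floor_le (k.+1%:R * a); have h2 := floorD1_gt (k.+1%:R * a).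
rewrite intrD in h2.
have ke : k.+1%:R^-1 < e by near: k; exact: near_infty_natSinv_lt (PosNum e0).
rewrite (_ : a - _ = (k.+1%:R * a - (Num.floor (k.+1%:R * a))%:~R) / k.+1%:R); last by field.
rewrite ger0_norm ?divr_ge0 ?subr_ge0//; apply: le_lt_trans ke.
by rewrite ler_pdivrMr // mulVf ?gt_eqF//; lra.
Unshelve. all: by end_near. Qed.

Definition periodic_row g := forall x (z : 'rV[int]_d), g (x + map_mx intr z) = g x.

Lemma periodic_continuous_bounded g : continuous g -> periodic_row g ->
  exists2 B, 0 <= B & forall x, `|g x| <= B.
Proof.
move=> cg pg.
pose A := [set v : 'rV[R]_d | forall i, `[0, 1]%classic (v ord0 i)].
have cA : compact A by apply: (@rV_compact R d (fun=> `[0, 1]%classic)) => i; exact: segment_compact.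
have := compact_bounded (continuous_compact (continuous_subspaceT cg) cA).
move=> [M [_ hM]]; exists (Num.max 0 (M + 1)); first by rewrite le_max lexx.
move=> x; pose z : 'rV[int]_d := \row_i - Num.floor (x 0 i).
rewrite -(pg x z) le_max; apply/orP; right; apply: (hM (M + 1)); first by rewrite ltrDl.
exists (x + map_mx intr z) => // i.
rewrite /= in_itv /= !mxE mulrNz subr_ge0 floor_le /=.
by have := floorD1_gt (x 0 i); rewrite intrD; lra.
Qed.

(** A tensor product of de la Vallee Poussin kernels: nonnegative, 1-periodic in each coordinate, of
    total mass 1 since Phi(n, 0) is the mean of cos^(2n). It takes the place of the classical Fejer
    kernel. *)
Definition fejer n x y : R := \prod_(i < d) (cos (pi * (x 0 i - y 0 i)) ^+ (2 * n) / Phi R n 0).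

(** On the cube, which has finite measure, this implies integrability, and unlike integrability it
    is stable under products. *)
Definition bounded_measurable (h : d.-tuple mR -> R) :=
  measurable_fun setT h /\ exists B, forall t, `|h t| <= B.

Lemma integrable_bounded h : bounded_measurable h ->
  mud.-integrable (@unit_cube R d) (EFin \o h).
Proof.
move=> [mh [B hB]]; apply: measurable_bounded_integrable.
- by rewrite unit_cubeE; exact: measurable_box.
- apply: (@le_lt_trans _ _ ((1 - 0) ^+ d)%:E); last exact: ltry.
  by rewrite -(lebesgue_tuple_box d (@ltr01 R)).
- exact: measurable_funTS.
- exists B; split; first by rewrite num_real.
  by move=> M /ltW BM t _; apply: le_trans BM; exact: hB.
Qed.

Lemma bounded_measurableM h1 h2 : bounded_measurable h1 -> bounded_measurable h2 ->
  bounded_measurable (fun t => h1 t * h2 t).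
Proof.
move=> [m1 [B1 b1]] [m2 [B2 b2]]; split; first exact: measurable_funM.
by exists (B1 * B2) => t; rewrite normrM ler_pM.
Qed.

Lemma bounded_measurableD h1 h2 : bounded_measurable h1 -> bounded_measurable h2 ->
  bounded_measurable (fun t => h1 t + h2 t).
Proof.
move=> [m1 [B1 b1]] [m2 [B2 b2]]; split; first exact: measurable_funD.
by exists (B1 + B2) => t; apply: le_trans (ler_normD _ _) _; rewrite lerD.
Qed.

Lemma bounded_measurable_cst (c : R) : bounded_measurable (fun=> c).
Proof. by split; [exact: measurable_cst | exists `|c|]. Qed.

Lemma bounded_measurableB h1 h2 : bounded_measurable h1 -> bounded_measurable h2 ->
  bounded_measurable (fun t => h1 t - h2 t).
Proof.
move=> b1 b2.
have := bounded_measurableD b1 (bounded_measurableM (bounded_measurable_cst (-1)) b2).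
by congr bounded_measurable; apply/funext => t; rewrite mulN1r.
Qed.

Lemma bounded_measurable_cos_pow (m : 'I_d -> R) (c : R) k :
  bounded_measurable (fun t => cos (pi * (\sum_(i < d) m i * tnth t i + c)) ^+ k).
Proof.
split; first exact: measurable_cos_pow_form.
by exists 1 => t; rewrite normrX exprn_ile1 // cos_max.
Qed.

Lemma bounded_measurable_prod (I : Type) (s : seq I) (h : I -> d.-tuple mR -> R) :
  (forall i, bounded_measurable (h i)) ->
  bounded_measurable (fun t => \prod_(i <- s) h i t).
Proof.
move=> bh; elim: s => [|i s IH].
  by under eq_fun do rewrite big_nil; exact: bounded_measurable_cst.
by under eq_fun do rewrite big_cons; exact: bounded_measurableM.
Qed.

Lemma bounded_measurable_sum (I : Type) (s : seq I) (h : I -> d.-tuple mR -> R) :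
  (forall i, bounded_measurable (h i)) ->
  bounded_measurable (fun t => \sum_(i <- s) h i t).
Proof.
move=> bh; elim: s => [|i s IH].
  by under eq_fun do rewrite big_nil; exact: bounded_measurable_cst.
by under eq_fun do rewrite big_cons; exact: bounded_measurableD.
Qed.

Lemma bounded_measurable_cos_coord (i : 'I_d) (c : R) k :
  bounded_measurable (fun t => cos (pi * (c - tnth t i)) ^+ k).
Proof.
have := bounded_measurable_cos_pow (fun j => if j == i then -1 else 0) c k.
congr bounded_measurable; apply/funext => t; rewrite (bigD1 i) //= eqxx big1.
  by rewrite addr0 mulN1r [- _ + _]addrC.
by move=> j /negbTE ->; rewrite mul0r.
Qed.

Lemma bounded_measurable_fejer n x : bounded_measurable (fun t => fejer n x (row t)).
Proof.
apply: bounded_measurable_prod => i.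
under eq_fun do rewrite mxE.
by apply: bounded_measurableM; [exact: bounded_measurable_cos_coord | exact: bounded_measurable_cst].
Qed.

Lemma fejer_ge0 n x y : 0 <= fejer n x y.
Proof.
by apply: prodr_ge0 => i _; rewrite divr_ge0 ?cos_pow_ge0 // ltW // Phi0_gt0.
Qed.

Lemma integral01_cos_pow n (c : R) :
  (\int[mu]_(x in `[0%R, 1%R[) (cos (pi * (c - x)) ^+ (2 * n))%:E = (Phi R n 0)%:E)%E.
Proof.
have := @integral_cos_pow R (-1) c n 0 1 isT isT.
rewrite subr0 mulr1 => <-; apply: eq_integral => x _.
by rewrite mulrNz mulN1r [- x + c]addrC.
Qed.

Definition fejer1 n (c y : R) : R := cos (pi * (c - y)) ^+ (2 * n) / Phi R n 0.

Lemma fejer1_ge0 n (c y : R) : 0 <= fejer1 n c y.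
Proof. by rewrite divr_ge0 ?cos_pow_ge0 // ltW // Phi0_gt0. Qed.

Lemma measurable_cos1 (c : R) k : measurable_fun setT (fun y : R => cos (pi * (c - y)) ^+ k).
Proof.
apply: continuous_measurable_fun.
rewrite (_ : (fun y : R => _) = (fun y : R => cos (pi * (-1 * y + c)) ^+ k)).
  exact: continuous_cos_pow.
by apply/funext => y; rewrite mulN1r addrC.
Qed.

Lemma measurable_fejer1 n c : measurable_fun setT (fejer1 n c).
Proof. by apply: measurable_funM => //; exact: measurable_cos1. Qed.

Lemma sin_sqE (z : R) : sin z ^+ 2 = 1 - cos z ^+ 2.
Proof. by rewrite -(cos2Dsin2 z) addrAC subrr add0r. Qed.

Lemma measurable_sin_sq (c : R) : measurable_fun setT (fun y : R => sin (pi * (c - y)) ^+ 2).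
Proof.
under eq_fun do rewrite sin_sqE.
by apply: measurable_funB => //; exact: measurable_cos1.
Qed.

Lemma integral_fejer1 n (c : R) : (\int[mu]_(x in `[0%R, 1%R[) (fejer1 n c x)%:E = 1%:E)%E.
Proof.
have P0 := Phi0_gt0 R n.
under eq_integral do rewrite /fejer1 mulrC EFinM.
rewrite ge0_integralZl_EFin //.
- by rewrite [X in (_ * X)%E]integral01_cos_pow -EFinM mulVf ?gt_eqF.
- by move=> y _; rewrite lee_fin cos_pow_ge0.
- apply: measurable_funTS; apply/measurable_EFinP; exact: measurable_cos1.
- by rewrite invr_ge0 ltW.
Qed.

(** Since sin^2 = 1 - cos^2, the moment is 1 - Phi(n+1, 0)/Phi(n, 0) = 1/(2n+2). The proof splits
    [fejer1 n] as the sin^2 part plus a multiple of [fejer1 n.+1], so that every integrand is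
    nonnegative and no integrability has to be checked. *)
Lemma integral_sin_fejer1 n (c : R) :
  (\int[mu]_(y in `[0%R, 1%R[) (sin (pi * (c - y)) ^+ 2 * fejer1 n c y)%:E =
   ((2 * n%:R + 2)^-1)%:E)%E.
Proof.
have P0 := Phi0_gt0 R n; have PS := Phi0S R n.
have n0 : 2 * n%:R + 2 != 0 :> R by rewrite gt_eqF// ltr_wpDl ?mulr_ge0.
pose r : R := Phi R n.+1 0 / Phi R n 0.
have rE : 1 - r = (2 * n%:R + 2)^-1.
  have qE : Phi R n.+1 0 = (2 * n%:R + 1) * Phi R n 0 / (2 * n%:R + 2).
    by rewrite -PS mulrC mulKf.
  have p0 := lt0r_neq0 P0; rewrite /r qE; move: (Phi R n 0) p0 => p p0.
  by field; rewrite p0 n0.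
have rr : 0 <= r by rewrite divr_ge0 // ltW // Phi0_gt0.
have := integral_fejer1 n c.
under eq_integral => y _.
  rewrite (_ : fejer1 n c y = sin (pi * (c - y)) ^+ 2 * fejer1 n c y + r * fejer1 n.+1 c y).
    over.
  rewrite sin_sqE mulrBl mul1r (_ : r * _ = cos (pi * (c - y)) ^+ 2 * fejer1 n c y) ?subrK //.
  rewrite /r /fejer1 (_ : (2 * n.+1 = 2 + 2 * n)%N) ?exprD; last by lia.
  by field; rewrite !gt_eqF ?Phi0_gt0.
under eq_integral do rewrite EFinD.
rewrite ge0_integralD //.
- move=> h; rewrite -rE EFinB -h.
  under [X in (_ = _ + X - _)%E]eq_integral do rewrite EFinM.
  rewrite ge0_integralZl_EFin //.
  + by rewrite [X in (_ = _ + _ * X - _)%E]integral_fejer1 -EFinM mulr1 addeK.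
  + by move=> y _; rewrite lee_fin fejer1_ge0.
  + by apply: measurable_funTS; apply/measurable_EFinP; exact: measurable_fejer1.
- by move=> y _; rewrite lee_fin mulr_ge0 ?fejer1_ge0 ?sqr_ge0.
- apply: measurable_funTS; apply/measurable_EFinP; apply: measurable_funM.
    exact: measurable_sin_sq.
  exact: measurable_fejer1.
- by move=> y _; rewrite lee_fin mulr_ge0 ?fejer1_ge0.
- apply: measurable_funTS; apply/measurable_EFinP; apply: measurable_funM => //.
  exact: measurable_fejer1.
Qed.

Lemma integral_fejer n x : \int[mud]_(t in @unit_cube R d) fejer n x (row t) = 1.
Proof.
rewrite /Rintegral unit_cubeE.
transitivity (fine (\int[mud]_(t in box 0 1 d) (\prod_(i < d) fejer1 n (x 0 i) (tnth t i))%:E)).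
  by congr fine; apply: eq_integral => t _; congr (_%:E); apply: eq_bigr => i _; rewrite mxE.
rewrite (@integral_box_prod R 0 1 d (fun i => fejer1 n (x 0 i)) (fun=> 1)) ?big1 //.
- by move=> i; exact: measurable_fejer1.
- by move=> i y; exact: fejer1_ge0.
- by move=> i; exact: integral_fejer1.
Qed.

Lemma integral_sin_fejer n x i :
  \int[mud]_(t in @unit_cube R d) (sin (pi * (x 0 i - tnth t i)) ^+ 2 * fejer n x (row t)) =
  (2 * n%:R + 2)^-1.
Proof.
rewrite /Rintegral unit_cubeE.
pose h (j : 'I_d) (y : R) : R :=
  (if j == i then sin (pi * (x 0 j - y)) ^+ 2 else 1) * fejer1 n (x 0 j) y.
transitivity (fine (\int[mud]_(t in box 0 1 d) (\prod_(i < d) h i (tnth t i))%:E)).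
  congr fine; apply: eq_integral => t _; congr (_%:E); rewrite big_split /=.
  rewrite -big_mkcond /= big_pred1_eq; congr (_ * _).
  by apply: eq_bigr => j _; rewrite mxE.
rewrite (@integral_box_prod _ _ _ _ _ (fun j => if j == i then (2 * n%:R + 2)^-1 else 1)).
- by rewrite -big_mkcond /= big_pred1_eq.
- move=> j; apply: measurable_funM; last exact: measurable_fejer1.
  by case: (j == i) => //; exact: measurable_sin_sq.
- by move=> j y; rewrite mulr_ge0 ?fejer1_ge0 //; case: ifP => _ //; rewrite sqr_ge0.
- move=> j; rewrite /h; case: ifP => _; last first.
    by under eq_integral do rewrite mul1r; exact: integral_fejer1.
  exact: integral_sin_fejer1.
Qed.

(** If y is within eta of x modulo integers in every coordinate, continuity gives the bound e.
    Otherwise some sin^2 is at least eta^2, and 2B/eta^2 times it exceeds the trivial bound 2B. *)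
Lemma modulus_sin g x (e : R) : continuous g -> periodic_row g -> 0 < e ->
  exists2 C, 0 <= C &
    forall y, `|g y - g x| <= e + C * \sum_(i < d) sin (pi * (x 0 i - y 0 i)) ^+ 2.
Proof.
move=> cg pg e0; have [B B0 hB] := periodic_continuous_bounded cg pg.
have /cvgrPdist_lt /(_ e e0) := cg x.
move=> /nbhs_ballP[eta /= eta0 heta].
have se y : 0 <= \sum_(i < d) sin (pi * (x 0 i - y 0 i)) ^+ 2 by apply: sumr_ge0 => i _; exact: sqr_ge0.
exists (2 * B / eta ^+ 2); first by rewrite divr_ge0 ?sqr_ge0 // mulr_ge0.
move=> y.
have /choice [z hz] i := dist_int_nearest (x 0 i - y 0 i).
have [small|] := pselect (forall i, dist_int (x 0 i - y 0 i) < eta).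
  rewrite -(pg y (\row_i z i)) -normrN opprB.
  apply: (@le_trans _ _ e); last by rewrite lerDl mulr_ge0 // divr_ge0 ?sqr_ge0 // mulr_ge0.
  apply/ltW/heta; rewrite mx_norm_ball /ball_ /=.
  apply: row_dist_lt => // i; rewrite !mxE opprD addrA.
  by rewrite -(hz i).1.
move=> /existsNP[i /negP]; rewrite -leNgt => hi.
apply: (@le_trans _ _ (2 * B)).
  by apply: le_trans (ler_normB _ _) _; have := hB x; have := hB y; lra.
apply: (@le_trans _ _ (2 * B / eta ^+ 2 * eta ^+ 2)).
  by rewrite mulfVK // expf_neq0 // gt_eqF.
apply: ler_wpDl; first exact: ltW.
apply: ler_wpM2l; first by rewrite divr_ge0 ?sqr_ge0 // mulr_ge0.
apply: le_trans (_ : dist_int (x 0 i - y 0 i) ^+ 2 <= _).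
  by rewrite lerXn2r ?nnegrE ?dist_int_ge0 // ltW.
apply: le_trans (sqr_dist_int_le_sin _) _.
by rewrite (bigD1 i) //= lerDl sumr_ge0 // => j _; exact: sqr_ge0.
Qed.

Lemma bounded_measurable_continuous g : continuous g -> periodic_row g ->
  bounded_measurable (fun t => g (row t)).
Proof.
move=> cg pg; split; first exact: measurable_continuous_row.
by have [B _ hB] := periodic_continuous_bounded cg pg; exists B => t.
Qed.

Lemma bounded_measurable_sin i (c : R) : bounded_measurable (fun t => sin (pi * (c - tnth t i)) ^+ 2).
Proof.
under eq_fun do rewrite sin_sqE.
apply: bounded_measurableB; first exact: bounded_measurable_cst.
exact: bounded_measurable_cos_coord.
Qed.

Lemma measurable_cube : measurable (@unit_cube R d).
Proof. by rewrite unit_cubeE; exact: measurable_box. Qed.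

Lemma RintegralD_bounded h1 h2 : bounded_measurable h1 -> bounded_measurable h2 ->
  \int[mud]_(t in @unit_cube R d) (h1 t + h2 t) =
  \int[mud]_(t in @unit_cube R d) h1 t + \int[mud]_(t in @unit_cube R d) h2 t.
Proof.
by move=> b1 b2; apply: RintegralD; [exact: measurable_cube | exact: integrable_bounded..].
Qed.

Lemma RintegralZ_bounded c h : bounded_measurable h ->
  \int[mud]_(t in @unit_cube R d) (c * h t) = c * \int[mud]_(t in @unit_cube R d) h t.
Proof.
by move=> b1; apply: RintegralZl; [exact: measurable_cube | exact: integrable_bounded].
Qed.

Lemma Rintegral_sum_bounded (I : Type) (s : seq I) (h : I -> d.-tuple mR -> R) :
  (forall i, bounded_measurable (h i)) ->
  \int[mud]_(t in @unit_cube R d) (\sum_(i <- s) h i t) =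
  \sum_(i <- s) \int[mud]_(t in @unit_cube R d) h i t.
Proof.
move=> bh; elim: s => [|i s IH].
  rewrite big_nil; under eq_Rintegral do rewrite big_nil.
  by rewrite Rintegral_cst ?mul0r //; exact: measurable_cube.
rewrite big_cons -IH; under eq_Rintegral do rewrite big_cons.
by rewrite RintegralD_bounded //; exact: bounded_measurable_sum.
Qed.

(* The kernel is a product of normalised powers of cosines, so its second moments
   against sin^2 are explicit: Korovkin's test functions are 1 and sin^2. *)
Lemma fejer_approx g x (e : R) : continuous g -> periodic_row g -> 0 < e ->
  exists n0, forall n, (n0 <= n)%N ->
    `|\int[mud]_(t in @unit_cube R d) (g (row t) * fejer n x (row t)) - g x| <= e.
Proof.
move=> cg pg e0; have e2 : 0 < e / 2 by rewrite divr_gt0.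
have [C C0 hC] := modulus_sin x cg pg e2.
(* The d second moments contribute C d/(2n+2), which is at most e/2 as soon as n + 1 >= C d/e. *)
pose n0 := Num.truncn (C * d%:R / e); exists n0 => n n0n.
have bg := bounded_measurable_continuous cg pg.
have bK := bounded_measurable_fejer n x.
have bgc := bounded_measurableB bg (bounded_measurable_cst (g x)).
have bgK := bounded_measurableM bgc bK.
have -> : \int[mud]_(t in @unit_cube R d) (g (row t) * fejer n x (row t)) - g x =
          \int[mud]_(t in @unit_cube R d) ((g (row t) - g x) * fejer n x (row t)).
  rewrite -{1}[g x]mulr1 -(integral_fejer n x) -RintegralZ_bounded //.
  rewrite -RintegralB; last 3 first.
  - exact: measurable_cube.
  - by apply: integrable_bounded; exact: bounded_measurableM.
  - by apply: integrable_bounded; apply: bounded_measurableM => //; exact: bounded_measurable_cst.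
  by apply: eq_Rintegral => t _; rewrite mulrBl.
apply: le_trans (le_normr_Rintegral measurable_cube (integrable_bounded bgK)) _.
pose S i t := sin (pi * (x 0 i - tnth t i)) ^+ 2 * fejer n x (row t).
have bS i : bounded_measurable (S i).
  by apply: bounded_measurableM => //; exact: bounded_measurable_sin.
pose H t := e / 2 * fejer n x (row t) + C * \sum_(i < d) S i t.
have bH1 : bounded_measurable (fun t => e / 2 * fejer n x (row t)).
  by apply: bounded_measurableM => //; exact: bounded_measurable_cst.
have bH2' : bounded_measurable (fun t => \sum_(i < d) S i t) by exact: bounded_measurable_sum.
have bH2 : bounded_measurable (fun t => C * \sum_(i < d) S i t).
  by apply: bounded_measurableM => //; exact: bounded_measurable_cst.
apply: (@le_trans _ _ (\int[mud]_(t in @unit_cube R d) H t)).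
  apply: le_Rintegral.
  - exact: measurable_cube.
  - have := integrable_bounded bgK => /integrable_abse.
    by congr (integrable _ _ _).
  - by apply: integrable_bounded; exact: bounded_measurableD.
  - move=> t _; rewrite normrM (ger0_norm (fejer_ge0 _ _ _)) /H /S.
    rewrite -mulr_suml mulrA -mulrDl ler_wpM2r ?fejer_ge0 //.
    apply: le_trans (hC _) _; rewrite lerD2l; apply: ler_wpM2l => //.
    by apply: ler_sum => i _; rewrite mxE.
rewrite /H RintegralD_bounded // !RintegralZ_bounded // integral_fejer mulr1.
rewrite Rintegral_sum_bounded //.
under eq_bigr => i _ do rewrite integral_sin_fejer.
rewrite sumr_const card_ord -[X in C * X]mulr_natr.
have n1 : 0 < 2 * n%:R + 2 :> R by rewrite ltr_wpDl ?mulr_ge0.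
suff : C * ((2 * n%:R + 2)^-1 * d%:R) <= e / 2 by lra.
rewrite mulrCA mulrC ler_pdivrMr //.
have := truncnS_gt (C * d%:R / e); rewrite -/n0 ltr_pdivrMr // -(natr1 n0).
have : n0%:R <= n%:R :> R by rewrite ler_nat.
by move: n1; nra.
Qed.

End Korovkin.

(** * Trigonometric means of complex functions and reduction of the discrepancy *)

Section ComplexFourier.
Variables (R : realType) (d : nat).
Notation mR := (measurableTypeR R).
Local Notation mud := (lebesgue_tuple R d).
Local Notation row := (@row_of_tuple R d).
Implicit Types (x y : 'rV[R]_d) (f F G : 'rV[R]_d -> R[i]) (m : 'rV[int]_d).

Definition bounded_measurablec F :=
  bounded_measurable (fun t : d.-tuple mR => complex.Re (F (row t))) /\
  bounded_measurable (fun t : d.-tuple mR => complex.Im (F (row t))).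

Lemma ReM (a b : R[i]) : complex.Re (a * b) = complex.Re a * complex.Re b - complex.Im a * complex.Im b.
Proof. by case: a b => [? ?] [? ?]. Qed.

Lemma ImM (a b : R[i]) : complex.Im (a * b) = complex.Re a * complex.Im b + complex.Im a * complex.Re b.
Proof. by case: a b => [? ?] [? ?]. Qed.

Lemma ReD (a b : R[i]) : complex.Re (a + b) = complex.Re a + complex.Re b.
Proof. by case: a b => [? ?] [? ?]. Qed.

Lemma ImD (a b : R[i]) : complex.Im (a + b) = complex.Im a + complex.Im b.
Proof. by case: a b => [? ?] [? ?]. Qed.

Lemma eqc (a b : R[i]) : complex.Re a = complex.Re b -> complex.Im a = complex.Im b -> a = b.
Proof. by case: a b => [? ?] [? ?] /= -> ->. Qed.

Lemma bounded_measurablecM F G : bounded_measurablec F -> bounded_measurablec G ->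
  bounded_measurablec (fun x => F x * G x).
Proof.
move=> [F1 F2] [G1 G2]; split.
  by under eq_fun do rewrite ReM; apply: bounded_measurableB; exact: bounded_measurableM.
by under eq_fun do rewrite ImM; apply: bounded_measurableD; exact: bounded_measurableM.
Qed.

Lemma bounded_measurablecD F G : bounded_measurablec F -> bounded_measurablec G ->
  bounded_measurablec (fun x => F x + G x).
Proof.
move=> [F1 F2] [G1 G2]; split.
  by under eq_fun do rewrite ReD; exact: bounded_measurableD.
by under eq_fun do rewrite ImD; exact: bounded_measurableD.
Qed.

Lemma bounded_measurablec_cst (c : R[i]) : bounded_measurablec (fun=> c).
Proof. by split; exact: bounded_measurable_cst. Qed.

Lemma bounded_measurablec_e2pi m (c : R) : bounded_measurablec (fun x => e2pi (c - dotmz m x)).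
Proof.
have E t : 2 * pi * (c - dotmz m (row t)) =
    pi * (\sum_(i < d) (- (2 * (m 0 i)%:~R)) * tnth t i + 2 * c).
  rewrite (_ : \sum_(i < d) _ = - (2 * dotmz m (row t))); first by ring.
  by rewrite /dotmz mulr_sumr -sumrN; apply: eq_bigr => i _; rewrite mxE; ring.
have mf c' : measurable_fun [set: d.-tuple mR] (fun t =>
    pi * (\sum_(i < d) (- (2 * (m 0 i)%:~R)) * tnth t i + c') : R).
  by apply: measurable_funM => //; exact: measurable_linear_form.
split; (split; last by exists 1 => t; rewrite /= ?cos_max ?sin_max).
  under eq_fun do rewrite /= E; apply: measurableT_comp (mf _).
  by apply: continuous_measurable_fun; exact: continuous_cos.
under eq_fun do rewrite /= E; apply: measurableT_comp (mf _).
by apply: continuous_measurable_fun; exact: continuous_sin.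
Qed.

Lemma torus_integralD F G : bounded_measurablec F -> bounded_measurablec G ->
  torus_integral (fun x => F x + G x) = torus_integral F + torus_integral G.
Proof.
move=> [F1 F2] [G1 G2]; apply: eqc; rewrite ?ReD ?ImD /=.
  by under eq_Rintegral do rewrite ReD; rewrite RintegralD_bounded.
by under eq_Rintegral do rewrite ImD; rewrite RintegralD_bounded.
Qed.

Lemma torus_integralZ (a : R[i]) F : bounded_measurablec F ->
  torus_integral (fun x => a * F x) = a * torus_integral F.
Proof.
move=> [F1 F2].
have bc c h : bounded_measurable h -> bounded_measurable (fun t : d.-tuple mR => c * h t : R).
  by move=> bh; apply: bounded_measurableM => //; exact: bounded_measurable_cst.
apply: eqc; rewrite ?ReM ?ImM /=.
  under eq_Rintegral do rewrite ReM -mulNr; rewrite RintegralD_bounded; try exact: bc.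
  by rewrite !RintegralZ_bounded // mulNr.
under eq_Rintegral do rewrite ImM; rewrite RintegralD_bounded; try exact: bc.
by rewrite !RintegralZ_bounded.
Qed.

Lemma torus_integral_sum (I : Type) (s : seq I) (a : I -> R[i]) (F : I -> 'rV[R]_d -> R[i]) :
  (forall i, bounded_measurablec (F i)) ->
  torus_integral (fun x => \sum_(i <- s) a i * F i x) = \sum_(i <- s) a i * torus_integral (F i).
Proof.
move=> bF.
have bs s' : bounded_measurablec (fun x => \sum_(i <- s') a i * F i x).
  elim: s' => [|i s' IH].
    by under eq_fun do rewrite big_nil; exact: bounded_measurablec_cst.
  under eq_fun do rewrite big_cons; apply: bounded_measurablecD => //.
  by apply: bounded_measurablecM => //; exact: bounded_measurablec_cst.
elim: s => [|i s IH].
  under eq_fun do rewrite big_nil; rewrite big_nil.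
  by rewrite /torus_integral /= Rintegral_cst ?mul0r //; exact: measurable_cube.
rewrite big_cons -IH -torus_integralZ // -torus_integralD //.
  by congr torus_integral; apply/funext => x; rewrite big_cons.
by apply: bounded_measurablecM => //; exact: bounded_measurablec_cst.
Qed.

Lemma normc_ge_Re (z : R[i]) : `|complex.Re z| <= Normc.normc z.
Proof. by case: z => a b /=; rewrite -sqrtr_sqr ler_wsqrtr // lerDl sqr_ge0. Qed.

Lemma normc_ge_Im (z : R[i]) : `|complex.Im z| <= Normc.normc z.
Proof. by case: z => a b /=; rewrite -sqrtr_sqr ler_wsqrtr // lerDr sqr_ge0. Qed.

Lemma normc_le_ReIm (z : R[i]) : Normc.normc z <= `|complex.Re z| + `|complex.Im z|.
Proof.
case: z => a b /=; rewrite -[leRHS]ger0_norm ?addr_ge0 // -sqrtr_sqr ler_wsqrtr //.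
rewrite sqrrD !real_normK ?num_real // [leRHS]addrAC lerDl mulrn_wge0 // mulr_ge0 //.
Qed.

Lemma continuous_Re_Im f : continuous (f : 'rV[R]_d -> R[i]^o) ->
  continuous (fun x => complex.Re (f x)) /\ continuous (fun x => complex.Im (f x)).
Proof.
move=> cf.
have near_normc x (e : R) : 0 < e -> \forall y \near x, Normc.normc (f x - f y) < e.
  move=> e0; have ec : 0 < (e%:C : R[i]) by rewrite ltcR.
  have /cvgrPdist_lt /(_ _ ec) := cf x; apply: filterS => y.
  by case: (f x) (f y) => [a b] [c d'] /=; rewrite ltcR.
split=> x; apply: (iffRL (@cvgrPdist_lt _ R _ (nbhs x) _ _ _)) => e e0;
  have := near_normc x e e0; apply: filterS => y; apply: le_lt_trans.
  by have := normc_ge_Re (f x - f y); case: (f x) (f y) => [a b] [c d'].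
by have := normc_ge_Im (f x - f y); case: (f x) (f y) => [a b] [c d'].
Qed.

Lemma bounded_measurablec_continuous f : continuous (f : 'rV[R]_d -> R[i]^o) -> Zd_periodic f ->
  bounded_measurablec f.
Proof.
move=> /continuous_Re_Im[c1 c2] pf; split.
  by apply: (bounded_measurable_continuous c1) => x z; rewrite pf.
by apply: (bounded_measurable_continuous c2) => x z; rewrite pf.
Qed.

Definition fejer_mean n f x : R[i] := torus_integral (fun y => f y * (fejer n x y)%:C).

Lemma fejer_mean_approx f x (e : R) : continuous (f : 'rV[R]_d -> R[i]^o) -> Zd_periodic f -> 0 < e ->
  exists n0, forall n, (n0 <= n)%N -> Normc.normc (f x - fejer_mean n f x) <= e.
Proof.
move=> /continuous_Re_Im[c1 c2] pf e0; have e2 : 0 < e / 2 by rewrite divr_gt0.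
have [n1 h1] := fejer_approx x c1 (fun y z => congr1 (@complex.Re R) (pf y z)) e2.
have [n2 h2] := fejer_approx x c2 (fun y z => congr1 (@complex.Im R) (pf y z)) e2.
exists (maxn n1 n2) => n; rewrite geq_max => /andP[/h1 {}h1 /h2 {}h2].
apply: le_trans (normc_le_ReIm _) _; rewrite [e]splitr.
have -> : fejer_mean n f x = (\int[mud]_(t in @unit_cube R d) (complex.Re (f (row t)) * fejer n x (row t)))
     +i* (\int[mud]_(t in @unit_cube R d) (complex.Im (f (row t)) * fejer n x (row t))).
  by apply: eqc => /=; apply: eq_Rintegral => t _; rewrite ?ReM ?ImM /= ?mulr0 ?subr0 ?add0r.
by case: (f x) h1 h2 => a b /= h1 h2; rewrite lerD // distrC.
Qed.

Lemma bin_central_max n k : ('C(2 * n, k) <= 'C(2 * n, n))%N.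
Proof.
have mono k1 : (k1 <= n)%N -> ('C(2 * n, k1) <= 'C(2 * n, n))%N.
  move=> kn; rewrite -(subKn kn); elim: (n - k1)%N (leq_subr k1 n) => [|j IH jn]; first by rewrite subn0.
  apply: leq_trans (IH _); last by lia.
  have := mul_bin_left (2 * n) (n - j.+1); rewrite (_ : (n - j.+1).+1 = (n - j)%N); last by lia.
  move=> E; rewrite -(leq_pmul2l (_ : 0 < n - j)%N); last by lia.
  by rewrite E leq_mul2r; apply/orP; right; lia.
have [kn|nk] := leqP k n; first exact: mono.
have [k2|k2] := leqP k (2 * n); last by rewrite bin_small.
by rewrite -bin_sub //; apply: mono; lia.
Qed.

Definition fejer_freq n (k : {ffun 'I_d -> 'I_(2 * n).+1}) : 'rV[int]_d :=
  \row_i ((k i : nat)%:Z - n%:Z).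
Definition fejer_coef n (k : {ffun 'I_d -> 'I_(2 * n).+1}) : R :=
  \prod_(i < d) (Phi R n ((k i : nat)%:Z - n%:Z) / Phi R n 0).

Lemma fejer_coef_ge0 n k : 0 <= @fejer_coef n k.
Proof. by apply: prodr_ge0 => i _; rewrite divr_ge0 ?Phi_ge0. Qed.

(** The central binomial coefficient is the largest. Hence the means only shrink Fourier
    coefficients, and no constant is lost in [discrepancy_le]. *)
Lemma fejer_coef_le1 n k : @fejer_coef n k <= 1.
Proof.
apply: prodr_ile1 => i _; rewrite divr_ge0 ?Phi_ge0 //= ler_pdivrMr ?Phi0_gt0 // mul1r.
rewrite Phi_bin; last by have := ltn_ord (k i); lia.
by rewrite Phi0_bin ler_pM2r ?invr_gt0 ?exprn_gt0 // ler_nat bin_central_max.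
Qed.

Lemma fejer_freq_inj n : injective (@fejer_freq n).
Proof.
move=> k l /rowP h; apply/ffunP => i; apply: val_inj.
by have := h i; rewrite !mxE => /addIr [].
Qed.

Definition fejer_freq0 n : {ffun 'I_d -> 'I_(2 * n).+1} := [ffun=> inord n].

Lemma fejer_freq0E n : fejer_freq (fejer_freq0 n) = 0.
Proof. by apply/rowP => i; rewrite !mxE ffunE inordK ?subrr //; lia. Qed.

Lemma fejer_coef0 n : fejer_coef (fejer_freq0 n) = 1.
Proof.
apply: big1 => i _; rewrite ffunE inordK; last by lia.
by rewrite subrr divff // gt_eqF // Phi0_gt0.
Qed.

Lemma e2pi_sum (I : Type) (s : seq I) (u : I -> R) : e2pi (\sum_(i <- s) u i) = \prod_(i <- s) e2pi (u i).
Proof.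
elim: s => [|i s IH]; first by rewrite !big_nil e2pi0.
by rewrite !big_cons e2piD IH.
Qed.

(** Each factor is expanded by [cos_pow_sum], then the product is distributed over the sums: a
    multi-index k picks one frequency per coordinate. *)
Lemma fejer_expansion n x y : (fejer n x y)%:C =
  \sum_(k : {ffun 'I_d -> 'I_(2 * n).+1})
    ((fejer_coef k)%:C * e2pi (dotmz (fejer_freq k) x)) * e2pi (- dotmz (fejer_freq k) y).
Proof.
rewrite /fejer rmorph_prod /=.
have E i : ((cos (pi * (x 0 i - y 0 i)) ^+ (2 * n) / Phi R n 0)%:C : R[i]) =
    \sum_(k < (2 * n).+1) (Phi R n (k%:Z - n%:Z) / Phi R n 0)%:C *
        e2pi ((k%:Z - n%:Z)%:~R * (x 0 i - y 0 i)).
  rewrite rmorphM /= cos_pow_sum mulr_suml; apply: eq_bigr => k _.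
  by rewrite rmorphM /= mulrAC.
under eq_bigr do rewrite E.
rewrite bigA_distr_bigA /=; apply: eq_bigr => k _; rewrite big_split /=.
rewrite -mulrA -e2piD /fejer_coef rmorph_prod /=; congr (_ * _).
rewrite -e2pi_sum; congr e2pi; rewrite /dotmz -sumrB; apply: eq_bigr => i _.
by rewrite !mxE mulrBr.
Qed.

Lemma fejer_mean_expansion n f x : continuous (f : 'rV[R]_d -> R[i]^o) -> Zd_periodic f ->
  fejer_mean n f x = \sum_(k : {ffun 'I_d -> 'I_(2 * n).+1})
    ((fejer_coef k)%:C * e2pi (dotmz (fejer_freq k) x)) * fourier_coef f (fejer_freq k).
Proof.
move=> cf pf; rewrite /fejer_mean /fourier_coef -torus_integral_sum.
  congr torus_integral; apply/funext => y; rewrite fejer_expansion mulr_sumr.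
  by apply: eq_bigr => k _; rewrite mulrCA.
move=> k; apply: bounded_measurablecM; first exact: bounded_measurablec_continuous.
by have := bounded_measurablec_e2pi (fejer_freq k) 0; under eq_fun do rewrite sub0r.
Qed.

Lemma dotmzD m x y : dotmz m (x + y) = dotmz m x + dotmz m y.
Proof. by rewrite /dotmz -big_split; apply: eq_bigr => i _; rewrite mxE mulrDr. Qed.

Lemma dotmzZ m (c : R) x : dotmz m (c *: x) = c * dotmz m x.
Proof. by rewrite /dotmz mulr_sumr; apply: eq_bigr => i _; rewrite mxE mulrCA. Qed.

Lemma dotmz0 x : dotmz 0 x = 0.
Proof. by rewrite /dotmz big1 // => i _; rewrite mxE mul0r. Qed.

Lemma fourier_coef0 f : fourier_coef f 0 = torus_integral f.
Proof.
by congr torus_integral; apply/funext => y; rewrite dotmz0 oppr0 e2pi0 mulr1.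
Qed.

Lemma normc_sum (I : Type) (s : seq I) (P : pred I) (F : I -> R[i]) :
  Normc.normc (\sum_(i <- s | P i) F i) <= \sum_(i <- s | P i) Normc.normc (F i).
Proof.
elim/big_ind2 : _ => // [|a b c e h1 h2]; first by rewrite Normc.normc0.
exact: le_trans (le_normcD _ _) (lerD h1 h2).
Qed.

Lemma normc_real (a : R) : Normc.normc (a%:C : R[i]) = `|a|.
Proof. by rewrite /= expr0n /= addr0 sqrtr_sqr. Qed.

Lemma Phi_sum N : \sum_(j < (2 * N).+1) Phi R N (j%:Z - N%:Z) = 1.
Proof.
have := cos_pow_sum N (0 : R); rewrite mulr0 cos0 expr1n.
under eq_bigr do rewrite mulr0 e2pi0 mulr1.
by rewrite -rmorph_sum /= => -[<-].
Qed.

(* Pointwise approximation by Fejer-type means reduces the discrepancy to an explicit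
   trigonometric sum; neither Fourier inversion nor translation invariance is used. *)
Lemma discrepancy_le N alpha f x (B : R) : continuous (f : 'rV[R]_d -> R[i]^o) -> Zd_periodic f ->
  (forall s : seq 'rV[int]_d, uniq s -> 0 \notin s ->
     \sum_(m <- s) Normc.normc (fourier_coef f m) * cos (pi * dotmz m alpha) ^+ (2 * N) <= B) ->
  Normc.normc (discrepancy (@Phi R) N alpha f x) <= B.
Proof.
move=> cf pf hB; apply/ler_addgt0Pr => e e0.
pose xj (j : 'I_(2 * N).+1) := x + (j%:Z - N%:Z)%:~R *: alpha.
have /choice [n0 hn0] j := fejer_mean_approx (xj j) cf pf e0.
(* One order n serves all 2N+1 sample points. It may depend on x, N and e, because the bound B does
   not depend on n. *)
pose n := (\max_j n0 j)%N.
have hn j : Normc.normc (f (xj j) - fejer_mean n f (xj j)) <= e by apply: hn0; exact: leq_bigmax.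
rewrite /discrepancy (@fsum_int _ N); last by move=> k kN; rewrite Phi_out // mul0r.
pose c (j : 'I_(2 * N).+1) : R := Phi R N (j%:Z - N%:Z).
(* A is the approximation error, at most e because the weights are nonnegative with sum 1. D
   collects the nonzero frequencies: summing over j turns each character into cos^(2N), while
   frequency 0 contributes exactly the integral of f. *)
pose A := \sum_(j < (2 * N).+1) (c j)%:C * (f (xj j) - fejer_mean n f (xj j)).
pose D := \sum_(k | k != fejer_freq0 n) (fejer_coef k)%:C * e2pi (dotmz (fejer_freq k) x) *
   fourier_coef f (fejer_freq k) * (cos (pi * dotmz (fejer_freq k) alpha) ^+ (2 * N))%:C.
have E : \sum_(j < (2 * N).+1) (c j)%:C * fejer_mean n f (xj j) = torus_integral f + D.
  under eq_bigr do rewrite fejer_mean_expansion // mulr_sumr.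
  rewrite exchange_big /= (bigD1 (fejer_freq0 n)) //=; congr (_ + _).
    under eq_bigr do rewrite fejer_coef0 fejer_freq0E dotmz0 e2pi0 fourier_coef0 !mul1r.
    by rewrite -mulr_suml -rmorph_sum /= Phi_sum mul1r.
  apply: eq_bigr => k _; rewrite cos_pow_sum mulr_sumr; apply: eq_bigr => j _.
  by rewrite /xj dotmzD dotmzZ e2piD; ring.
have -> : \sum_(j < (2 * N).+1) (Phi R N (j%:Z - N%:Z))%:C * f (xj j) - torus_integral f = A + D.
  rewrite /A; under [in RHS]eq_bigr do rewrite mulrBr.
  by rewrite sumrB E opprD addrA subrK.
apply: le_trans (le_normcD _ _) _; rewrite addrC; apply: lerD.
  apply: le_trans (normc_sum _ _ _) _.
  apply: le_trans (hB [seq fejer_freq k | k <- index_enum _ & k != fejer_freq0 n] _ _).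
  - rewrite big_map big_filter; apply: ler_sum => k _.
    rewrite !Normc.normcM normc_e2pi mulr1 !normc_real (ger0_norm (fejer_coef_ge0 _)).
    rewrite (ger0_norm (cos_pow_ge0 _ _)) ler_wpM2r ?cos_pow_ge0 //.
    by rewrite ler_piMl ?fejer_coef_le1 //; case: (fourier_coef _ _) => *; exact: sqrtr_ge0.
  - rewrite map_inj_uniq; last exact: fejer_freq_inj.
    by rewrite filter_uniq // index_enum_uniq.
  - apply/mapP => -[k]; rewrite mem_filter => /andP[k0 _].
    by rewrite -(fejer_freq0E n) => /fejer_freq_inj h; rewrite h eqxx in k0.
apply: le_trans (normc_sum _ _ _) _.
apply: (@le_trans _ _ (\sum_(j < (2 * N).+1) c j * e)).
  apply: ler_sum => j _; rewrite Normc.normcM normc_real (ger0_norm (Phi_ge0 _ _ _)).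
  by apply: ler_wpM2l; [exact: Phi_ge0 | exact: hn].
by rewrite -mulr_suml Phi_sum mul1r.
Qed.

End ComplexFourier.

(** * Lattice sums over dyadic shells *)

Section PowerSums.
Variable R : realType.
Implicit Types (a b e r : R) (j J : nat).

Lemma powRDp a r e : 0 < a -> a `^ (r + e) = a `^ r * a `^ e.
Proof. by move=> a0; rewrite powRD // (gt_eqF a0) implybT. Qed.

Lemma powR_le_anti a b r : 0 < a -> a <= b -> 0 <= r -> b `^ (- r) <= a `^ (- r).
Proof.
move=> a0 ab r0; have b0 : 0 < b by exact: lt_le_trans ab.
rewrite !powRN lef_pV2 ?posrE ?powR_gt0 //.
by apply: ge0_ler_powR => //; rewrite nnegrE ltW.
Qed.

Lemma powR_le_mono a b r : 0 <= a -> a <= b -> 0 <= r -> a `^ r <= b `^ r.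
Proof.
by move=> a0 ab r0; apply: ge0_ler_powR => //; rewrite nnegrE // (le_trans a0).
Qed.

Lemma powR_expn j e : ((2 : R) ^+ j) `^ e = (2 `^ e) ^+ j.
Proof. by rewrite -(powR_mulrn j (ler0n R 2)) powRAC powR_mulrn ?powR_ge0. Qed.

Lemma powR2_gt1 e : 0 < e -> 1 < (2 : R) `^ e.
Proof.
by move=> e0; rewrite /powR gt_eqF // -[ltLHS]expR0 ltr_expR mulr_gt0 // ln_gt0 // ltr1n.
Qed.

(** The induction also carries the bound q^J/(q - 1), valid without reference to r. At each index J
    that passes the test 2^J <= r, this bound turns into the desired one. *)
Lemma geometric_up (r e : R) J : 0 < r -> 0 < e ->
  \sum_(j < J | 2 ^+ j <= r) (2 ^+ j) `^ e <= 2 `^ e / (2 `^ e - 1) * r `^ e.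
Proof.
move=> r0 e0; have q1 := powR2_gt1 e0; set q := 2 `^ e in q1 *.
have q0 : 0 < q - 1 by rewrite subr_gt0.
suff : \sum_(j < J | 2 ^+ j <= r) (2 ^+ j) `^ e <= q ^+ J / (q - 1) /\
       \sum_(j < J | 2 ^+ j <= r) (2 ^+ j) `^ e <= q / (q - 1) * r `^ e by case.
elim: J => [|J [IH1 IH2]].
  by rewrite !big_ord0 ?divr_ge0 ?mulr_ge0 ?invr_ge0 ?powR_ge0 //; lra.
rewrite !big_mkcond big_ord_recr -!big_mkcond /= powR_expn -/q.
have qJ : q ^+ J / (q - 1) + q ^+ J = q ^+ J.+1 / (q - 1).
  by rewrite exprS; field; rewrite gt_eqF.
have qJ0 : 0 <= q ^+ J by rewrite exprn_ge0 // powR_ge0.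
case: ifP => Jr; last first.
  split; last by rewrite addr0.
  by rewrite addr0 (le_trans IH1) // -qJ lerDl.
have H1 : \sum_(j < J | 2 ^+ j <= r) (2 ^+ j) `^ e + q ^+ J <= q ^+ J.+1 / (q - 1).
  by rewrite -qJ lerD2r.
split=> //; apply: le_trans H1 _; rewrite exprS mulrAC ler_wpM2l //.
  by rewrite divr_ge0 //; lra.
by rewrite /q -powR_expn; apply: powR_le_mono => //; lra.
Qed.

Lemma geometric_down (r e : R) J : 0 < r -> 0 < e ->
  \sum_(j < J | r < 2 ^+ j) (2 ^+ j) `^ (- e) <= (1 - 2 `^ (- e))^-1 * r `^ (- e).
Proof.
move=> r0 e0; have := powR2_gt1 e0; set q := 2 `^ (- e) => h.
have q1 : q < 1 by rewrite /q powRN invf_lt1 ?powR_gt0.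
have q0 : 0 < q by exact: powR_gt0.
set T := \sum_(j < J | _) _.
(* Either no term has been met yet, or the partial sum together with the whole remaining geometric
   tail obeys the bound; the second alternative is preserved by adding a term. *)
suff : T = 0 \/ T + q ^+ J / (1 - q) <= (1 - q)^-1 * r `^ (- e).
  case=> [->|h1]; first by rewrite mulr_ge0 ?invr_ge0 ?powR_ge0 //; lra.
  by apply: le_trans h1; rewrite lerDl divr_ge0 ?exprn_ge0 //; lra.
rewrite /T; elim: J {T} => [|J IH]; first by left; rewrite big_ord0.
have [rJ|Jr] := ltP r (2 ^+ J); last first.
  left; rewrite big1 // => -[j /= jJ] rj; exfalso; move: rj; apply/negP.
  by rewrite -leNgt (le_trans _ Jr) // ler_eXn2l ?ltr1n // -ltnS.
right; rewrite !big_mkcond big_ord_recr -!big_mkcond /= rJ powR_expn -/q -addrA.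
have qJ : q ^+ J + q ^+ J.+1 / (1 - q) = q ^+ J / (1 - q).
  by rewrite exprS; field; rewrite gt_eqF // subr_gt0.
rewrite qJ; case: IH => [->|//].
rewrite add0r mulrC ler_wpM2l ?invr_ge0 //; first by lra.
by rewrite /q -powR_expn; apply: powR_le_anti => //; apply: ltW.
Qed.

(** [geometric_down] at r = 1/2, where the condition on j is vacuous and r^-e = 2^e. *)
Lemma geometric_total (e : R) J : 0 < e ->
  \sum_(j < J) (2 ^+ j) `^ (- e) <= (1 - 2 `^ (- e))^-1 * 2 `^ e.
Proof.
move=> e0; have := @geometric_down (2^-1) e J; rewrite invr_gt0 ltr0n => /(_ isT e0).
rewrite (eq_bigl predT) => [|j]; last first.
  by rewrite (lt_le_trans (_ : _ < 1)) ?invf_lt1 ?ltr1n // exprn_ege1 // ler1n.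
by rewrite (_ : (2^-1 : R) `^ (- e) = 2 `^ e) // -powR_inv1 // -powRrM mulN1r opprK.
Qed.

Lemma count_pow2 (r : R) J : 1 <= r ->
  \sum_(j < J | 2 ^+ j <= r) 1 <= 1 + ln r / ln 2.
Proof.
move=> r1; have r0 : 0 < r by lra.
have l2 : 0 < ln (2 : R) by rewrite ln_gt0 // ltr1n.
suff : \sum_(j < J | 2 ^+ j <= r) 1 <= J%:R :> R /\
       \sum_(j < J | 2 ^+ j <= r) 1 <= 1 + ln r / ln 2 by case.
elim: J => [|J [IH1 IH2]].
  by split; rewrite big_ord0 // addr_ge0 // divr_ge0 ?(ltW l2) // ln_ge0.
rewrite !big_mkcond big_ord_recr -!big_mkcond /=; case: ifP => Jr; last first.
  by rewrite addr0; split=> //; rewrite -(natr1 J); lra.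
have H : (\sum_(j < J | 2 ^+ j <= r) 1) + 1 <= J.+1%:R :> R by rewrite -(natr1 J) lerD2r.
split=> //; apply: le_trans H _; rewrite -(natr1 J) addrC lerD2l ler_pdivlMr //.
by rewrite -ln_powR powR_mulrn // ler_ln ?posrE ?exprn_gt0.
Qed.

(* 1/(1+ak)^2 <= (1/a) (1/(1+a(k-1)) - 1/(1+ak)), which telescopes. *)
Lemma sum_decay (a r : R) B : 0 < a -> 1 <= r ->
  \sum_(1 <= k < B.+1) (1 + a * k%:R) `^ (- (r + 1)) <= a `^ (- r).
Proof.
move=> a0 r1.
have tel : \sum_(1 <= k < B.+1) ((1 + a * k%:R) ^+ 2)^-1 <= a^-1 * (1 - (1 + a * B%:R)^-1).
  elim: B => [|B IH]; first by rewrite big_geq // mulr0 addr0 invr1 subrr mulr0.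
  rewrite big_nat_recr //=; apply: le_trans (lerD IH (lexx _)) _.
  have B0 : 0 <= a * B%:R by rewrite mulr_ge0 // ltW.
  have -> : 1 + a * B.+1%:R = 1 + a * B%:R + a by rewrite -(natr1 B); ring.
  move: (a * B%:R) B0 => u u0.
  have [p1 p2] : 0 < 1 + u /\ 0 < 1 + u + a by split; lra.
  rewrite -subr_ge0 (_ : _ - _ = a / ((1 + u) * (1 + u + a) ^+ 2)).
    by rewrite divr_ge0 ?mulr_ge0 ?sqr_ge0 // ltW.
  by field; rewrite !gt_eqF.
(* The exponent r + 1 is split as (r - 1) + 2: the first part is spent on 1 + a k >= a, which uses k
   >= 1 and r >= 1, and the square telescopes. *)
apply: (@le_trans _ _ (\sum_(1 <= k < B.+1) a `^ (- (r - 1)) * ((1 + a * k%:R) ^+ 2)^-1)).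
  rewrite !big_nat; apply: ler_sum => k /andP[k1 _].
  have k1' : 1 <= k%:R :> R by rewrite ler1n.
  have ak : a <= 1 + a * k%:R by have := ler_peMr (ltW a0) k1'; lra.
  have p0 : 0 < 1 + a * k%:R by lra.
  rewrite (_ : - (r + 1) = - (r - 1) + - 2%:R); last by ring.
  rewrite powRDp // powR_invn ?(ltW p0) // ler_wpM2r ?invr_ge0 ?exprn_ge0 // ?(ltW p0) //.
  by apply: powR_le_anti => //; lra.
rewrite -mulr_sumr; apply: (@le_trans _ _ (a `^ (- (r - 1)) * a^-1)).
  apply: ler_wpM2l; first exact: powR_ge0.
  apply: le_trans tel _; rewrite ler_piMr ?invr_ge0 ?(ltW a0) // lerBlDr lerDl invr_ge0.
  by rewrite addr_ge0 // mulr_ge0 // ltW.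
rewrite -powR_inv1 ?(ltW a0) // -powRDp //.
by rewrite (_ : - (r - 1) + -1 = - r) //; ring.
Qed.

Lemma sum_uniq_nat (t : seq nat) (psi : nat -> R) B : uniq t -> (forall k, 0 <= psi k) ->
  (forall k, k \in t -> (0 < k <= B)%N) ->
  \sum_(k <- t) psi k <= \sum_(1 <= k < B.+1) psi k.
Proof.
move=> ut p0 ht.
rewrite (_ : \sum_(k <- t) psi k = \sum_(1 <= k < B.+1 | k \in t) psi k); last first.
  rewrite -[RHS]big_filter; apply: perm_big; apply: uniq_perm => //.
    by rewrite filter_uniq // iota_uniq.
  move=> k; rewrite mem_filter mem_index_iota; have := ht k.
  by case: (k \in t) => //= /(_ isT) ->.
rewrite big_mkcond; apply: ler_sum => k _; case: ifP => //.
Qed.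

End PowerSums.

(** * Dyadic shells of integer vectors *)

Section Lattice.
Variables (R : realType) (d : nat).
Implicit Types (m : 'rV[int]_d) (s : seq 'rV[int]_d).

Definition supnormz m : nat := \max_(i < d) absz (m 0%R i).
(** Shells are taken in the sup norm, where counting is immediate; comparison with the Euclidean
    norm costs at most a factor d. The vector 0 gets level 0 by default, so it is excluded from the
    lists below. *)
Definition level m : nat := trunc_log 2 (supnormz m).

Lemma supnormz_ge m i : (absz (m 0%R i) <= supnormz m)%N.
Proof. exact: leq_bigmax. Qed.

Lemma supnormz_gt0 m : m != 0 -> (0 < supnormz m)%N.
Proof.
apply: contraR; rewrite -eqn0Ngt => /eqP m0; apply/eqP/rowP => i; rewrite mxE.
by have := supnormz_ge m i; rewrite m0 leqn0 absz_eq0 => /eqP.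
Qed.

Lemma supnormz_level m : m != 0 -> (2 ^ level m <= supnormz m < 2 ^ (level m).+1)%N.
Proof. by move=> m0; apply: trunc_log_bounds => //; exact: supnormz_gt0. Qed.

Lemma supnormzB m m' (L : nat) : (supnormz m < L)%N -> (supnormz m' < L)%N -> (supnormz (m - m') <= 2 * L)%N.
Proof.
move=> h h'; apply/bigmax_leqP => i _; rewrite !mxE.
have := supnormz_ge m i; have := supnormz_ge m' i.
by move: h h' (m 0%R i) (m' 0%R i) => + + a b; lia.
Qed.

Lemma sqr_enormz m : enormz R m ^+ 2 = \sum_(i < d) (m 0 i)%:~R ^+ 2.
Proof. by rewrite /enormz sqr_sqrtr // sumr_ge0 // => i _; exact: sqr_ge0. Qed.

Lemma sqr_intr_abs (k : int) : (k%:~R : R) ^+ 2 = (absz k)%:R ^+ 2.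
Proof. by rewrite -[LHS]real_normK ?num_real // -intr_norm -abszE. Qed.

Lemma enormz_ge m : m != 0 -> ((2 : R) ^+ level m) ^+ 2 <= enormz R m ^+ 2.
Proof.
move=> m0; have /andP[h _] := supnormz_level m0.
have d0 : (0 < #|'I_d|)%N.
  rewrite lt0n; apply: contra_neq m0 => /card0_eq e0; apply/rowP => i; by have := e0 i.
have [i hi] := bigop.eq_bigmax (fun i => absz (m 0 i)) d0.
rewrite sqr_enormz (bigD1 i) //= sqr_intr_abs -hi -/(supnormz m) ler_wpDr ?sumr_ge0 // => [j _|].
  exact: sqr_ge0.
by rewrite lerXn2r ?nnegrE // -natrX ler_nat.
Qed.

Lemma enormz_le m (L : nat) : (supnormz m <= L)%N -> enormz R m <= d%:R * L%:R.
Proof.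
move=> mL; rewrite -(@ler_pXn2r _ 2) ?nnegrE ?sqrtr_ge0 // sqr_enormz.
apply: (@le_trans _ _ (d%:R * L%:R ^+ 2)).
  rewrite mulr_natl -[X in _ *+ X](card_ord d) -sumr_const; apply: ler_sum => i _.
  rewrite sqr_intr_abs lerXn2r ?nnegrE // ler_nat.
  exact: leq_trans (supnormz_ge _ _) mL.
rewrite exprMn ler_wpM2r ?sqr_ge0 // expr2 -natrM ler_nat.
by case: (d) => // k; rewrite leq_pmulr.
Qed.

Lemma enormz_gt0 m : m != 0 -> 0 < enormz R m.
Proof.
move=> m0; rewrite lt_neqAle sqrtr_ge0 andbT eq_sym -sqrf_eq0 gt_eqF //.
by apply: lt_le_trans (enormz_ge m0); rewrite !exprn_gt0.
Qed.

Lemma size_box_le s (L : nat) : uniq s -> (forall m, m \in s -> (supnormz m < L)%N) ->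
  (size s <= (2 * L) ^ d)%N.
Proof.
move=> us hs; case: L hs => [|L] hs.
  case: s us hs => // m s _ /(_ m (mem_head _ _)); by rewrite ltn0.
pose F m : {ffun 'I_d -> 'I_(2 * L).+2} := [ffun i => inord (absz (m 0 i + L.+1%:Z)%R)].
have Finj : {in s &, injective F}.
  move=> m m' /hs mL /hs mL' /ffunP E; apply/rowP => i; have := E i; rewrite !ffunE.
  have := supnormz_ge m i; have := supnormz_ge m' i => h1 h2.
  move=> /(congr1 val) /=; rewrite !inordK; lia.
rewrite -(size_map F) -(card_uniqP _) ?map_inj_in_uniq //.
apply: leq_trans (max_card _) _; rewrite card_ffun !card_ord.
by rewrite (_ : (2 * L.+1 = (2 * L).+2)%N) //; lia.
Qed.

Lemma size_level_le s j : uniq s -> 0 \notin s -> (forall m, m \in s -> level m = j) ->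
  (size s)%:R <= 4 ^+ d * ((2 : R) ^+ j) `^ d%:R.
Proof.
move=> us s0 hs.
have := @size_box_le s (2 ^ j.+1) us.
have hm m : m \in s -> (supnormz m < 2 ^ j.+1)%N.
  move=> ms; rewrite -(hs _ ms); have /supnormz_level/andP[] // : m != 0.
  by apply: contraNneq s0 => <-.
move=> /(_ hm) h; rewrite -(ler_nat R) in h; apply: le_trans h _.
rewrite powR_mulrn ?exprn_ge0 // natrX natrM natrX -exprMn exprS mulrA.
by rewrite (_ : 2 * 2 = 4 :> R) //; ring.
Qed.

Lemma sum_by_level s (F : 'rV[int]_d -> R) J : (forall m, m \in s -> (level m < J)%N) ->
  \sum_(m <- s) F m = \sum_(j < J) \sum_(m <- s | level m == j) F m.
Proof.
move=> hJ; rewrite (exchange_big_dep predT) //= [LHS]big_seq [RHS]big_seq.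
apply: eq_bigr => m ms; have := hJ _ ms => mJ.
by rewrite (big_pred1 (Ordinal mJ)) // => j; rewrite -val_eqE eq_sym.
Qed.

(** On shell j the weight is at most 2^(-2 j delta), so bounds shell by shell suffice. J depends on
    the list s, hence later estimates of the right side must be uniform in J. *)
Lemma sum_level_le s (F : 'rV[int]_d -> R) (delta : R) (E : nat -> R) : 0 <= delta ->
  uniq s -> 0 \notin s -> (forall m, 0 <= F m) ->
  (forall t j, uniq t -> 0 \notin t -> (forall m, m \in t -> level m = j) -> \sum_(m <- t) F m <= E j) ->
  exists J, \sum_(m <- s) (1 + enormz R m ^+ 2) `^ (- delta) * F m <=
    \sum_(j < J) (2 ^+ j) `^ (- (2 * delta)) * E j.
Proof.
move=> d0 us s0 F0 hE.
pose J := (\max_(m <- s) level m).+1; exists J.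
rewrite (@sum_by_level s _ J); last first.
  by move=> m ms; rewrite ltnS; exact: leq_bigmax_seq.
apply: ler_sum => j _.
apply: (@le_trans _ _ (\sum_(m <- s | level m == j) (2 ^+ j) `^ (- (2 * delta)) * F m)).
  rewrite big_seq_cond [leRHS]big_seq_cond; apply: ler_sum => m /andP[ms /eqP mj].
  apply: ler_wpM2r => //.
  have m0 : m != 0 by apply: contraNneq s0 => <-.
  rewrite -mulrN powRrM powR_mulrn ?exprn_ge0 //; apply: powR_le_anti => //.
  by rewrite -mj; apply: le_trans (enormz_ge m0) _; rewrite lerDr.
rewrite -mulr_sumr; apply: ler_wpM2l; first exact: powR_ge0.
rewrite -big_filter; apply: hE; first by rewrite filter_uniq.
  by rewrite mem_filter (negbTE s0) andbF.
by move=> m; rewrite mem_filter => /andP[/eqP].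
Qed.

End Lattice.

(** * Diophantine vectors *)

Section Diophantine.
Variables (R : realType) (d : nat) (alpha : 'rV[R]_d) (H sigma : R).
Hypothesis d_gt0 : (0 < d)%N.
Hypothesis H_gt0 : 0 < H.
Hypothesis sigma_ge : d%:R <= sigma.
Hypothesis dioph : forall m : 'rV[int]_d, m != 0 ->
  H * enormz R m `^ (- sigma) <= dist_int (dotmz m alpha).

Let dR : 0 < d%:R :> R. Proof. by rewrite ltr0n. Qed.
Let sigma_gt0 : 0 < sigma. Proof. exact: lt_le_trans sigma_ge. Qed.

Lemma dotmzB (m m' : 'rV[int]_d) (x : 'rV[R]_d) : dotmz (m - m') x = dotmz m x - dotmz m' x.
Proof. by rewrite /dotmz -sumrB; apply: eq_bigr => i _; rewrite !mxE intrB mulrBl. Qed.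

(* Fractional parts m.alpha of the same sign lying in the same interval of length h
   belong to the same m, so the values are spread out at least like h, 2h, 3h, ... *)
Lemma sum_level_dioph (r M : R) (s : seq 'rV[int]_d) j : 1 <= r -> 0 < M ->
  uniq s -> 0 \notin s -> (forall m, m \in s -> level m = j) ->
  \sum_(m <- s) (1 + M * dist_int (dotmz m alpha)) `^ (- (r + 1)) <=
    2 * (H `^ (- r) * (d%:R * 4) `^ (sigma * r)) * (M `^ (- r) * (2 ^+ j) `^ (sigma * r)).
Proof.
move=> r1 M0 us s0 hs; have r0 : 0 < r by lra.
have L0 : 0 < d%:R * (4 * 2 ^+ j) :> R by rewrite !mulr_gt0 // exprn_gt0.
(* Two vectors of shell j differ by a vector of sup norm at most 4 2^j, so of Euclidean norm at most
   d 4 2^j; h is the Diophantine lower bound for such a difference. *)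
pose h : R := H * (d%:R * (4 * 2 ^+ j)) `^ (- sigma).
have h0 : 0 < h by rewrite mulr_gt0 ?powR_gt0.
have hdist (k : 'rV[int]_d) : k != 0 -> (supnormz k <= 4 * 2 ^ j)%N -> h <= dist_int (dotmz k alpha).
  move=> k0 kL; apply: le_trans (dioph k0); rewrite ler_wpM2l ?(ltW H_gt0) //.
  apply: powR_le_anti; [exact: enormz_gt0 | | exact: ltW].
  by have := enormz_le R kL; rewrite natrM natrX.
have sm m : m \in s -> m != 0 /\ (supnormz m < 2 * 2 ^ j)%N.
  move=> ms; have m0 : m != 0 by apply: contraNneq s0 => <-.
  by split=> //; have /andP[_] := supnormz_level m0; rewrite (hs _ ms) expnS.
have /choice [n hn] m := dist_int_nearest (dotmz m alpha).
pose u m := dotmz m alpha - (n m)%:~R.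
have uE m : dist_int (dotmz m alpha) = `|u m| by have [] := hn m.
pose b m := Num.truncn (`|u m| / h).
have bP m : (b m)%:R * h <= `|u m| < (b m)%:R * h + h.
  rewrite -ler_pdivlMr // truncn_le divr_ge0 ?(ltW h0) //=.
  by have := truncnS_gt (`|u m| / h); rewrite ltr_pdivrMr // -(natr1 (b m)) mulrDl mul1r.
pose a := M * h; have a0 : 0 < a by rewrite mulr_gt0.
(* The sign must be fixed: |u m| and |u m'| in the same interval of length h force |u m - u m'| < h
   only for equal signs. The two signs give the factor 2. *)
have half (sg : bool) : \sum_(m <- s | (0 <= u m) == sg) (1 + M * dist_int (dotmz m alpha)) `^ (- (r + 1)) <= a `^ (- r).
  rewrite -big_filter; pose t := [seq m <- s | (0 <= u m) == sg]; rewrite -/t.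
  have ts m : m \in t -> m \in s /\ (0 <= u m) = sg by rewrite mem_filter => /andP[/eqP].
  have binj : {in t &, injective b}.
    move=> m m' /ts[ms um] /ts[ms' um'] bb; apply/eqP; rewrite -subr_eq0; apply/negP => /negP mm'.
    have := hdist _ mm' (leq_trans (supnormzB (sm _ ms).2 (sm _ ms').2) _).
    have L4 : (2 * (2 * 2 ^ j) <= 4 * 2 ^ j)%N by rewrite mulnA leqnn.
    move=> /(_ L4); apply/negP; rewrite -ltNge.
    apply: le_lt_trans (dist_int_le _ (n m - n m')) _.
    rewrite dotmzB (_ : _ - _ - _ = u m - u m'); last by rewrite intrB /u; ring.
    have := bP m; have := bP m'; rewrite -bb; move: um um' => <-.
    by case: (ger0P (u m)) => u1; case: (ger0P (u m')) => u2 // _; rewrite ltr_norml; lra.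
  apply: (@le_trans _ _ (\sum_(m <- t) (1 + a * (b m)%:R) `^ (- (r + 1)))).
    rewrite big_seq [leRHS]big_seq; apply: ler_sum => m mt.
    have b0 : 0 <= a * (b m)%:R by rewrite mulr_ge0 // ltW.
    apply: powR_le_anti; [by lra| |by lra].
    rewrite lerD2l uE /a -mulrA ler_wpM2l ?(ltW M0) // mulrC.
    by case/andP: (bP m).
  rewrite -(big_map b predT (fun k => (1 + a * k%:R) `^ (- (r + 1)))) /=.
  apply: le_trans (sum_decay (\max_(k <- map b t) k) a0 r1).
  apply: sum_uniq_nat.
  - by rewrite map_inj_in_uniq // filter_uniq.
  - by move=> k; exact: powR_ge0.
  (* The index [b m] is never 0, because the lower bound h applies to the nonzero vector m itself;
     hence the sum may start at k = 1. *)
  - move=> k /mapP[m mt ->]; rewrite truncn_gt0 ler_pdivlMr // mul1r -uE; apply/andP; split.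
      have [ms _] := ts _ mt; have [m0 mL] := sm _ ms.
      by apply: hdist => //; apply: ltnW; apply: leq_trans mL _; rewrite leq_mul2r orbT.
    by apply: leq_bigmax_seq => //; exact: map_f.
rewrite (bigID (fun m => (0 <= u m) == true)) /=.
have := half true; have := half false => h1 h2.
apply: (@le_trans _ _ (a `^ (- r) + a `^ (- r))).
  apply: lerD => //; apply: le_trans h1; rewrite le_eqVlt; apply/orP; left; apply/eqP.
  by apply: eq_bigl => m; case: (0 <= u m).
rewrite /a /h !powRM ?mulr_ge0 ?powR_ge0 ?exprn_ge0 ?(ltW M0) ?(ltW H_gt0) ?(ltW dR) //.
rewrite -!powRrM !mulrNN -mulrA.
by rewrite le_eqVlt; apply/orP; left; apply/eqP; ring.
Qed.

(** * Threshold estimates for the weighted sums *)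

Section Weighted.
Variable delta : R.
Hypothesis delta_gt : d%:R / 2 < delta.

Let delta_gt0 : 0 < delta. Proof. by apply: lt_trans delta_gt; rewrite divr_gt0. Qed.
Let gap_gt0 : 0 < 2 * delta - d%:R. Proof. by have := delta_gt; lra. Qed.

Definition weighted_sum N (s : seq 'rV[int]_d) : R :=
  \sum_(m <- s) (1 + enormz R m ^+ 2) `^ (- delta) * (cos (pi * dotmz m alpha) ^+ (2 * N)) ^+ 2.

(** r0 is a free threshold on 2^j: the Diophantine estimate is used up to it, the cardinality of the
    shells beyond. C does not depend on r0, which the callers choose in terms of N. *)
Lemma weighted_sum_split (r : R) : 1 <= r -> exists2 C, 0 <= C &
  forall N s (r0 : R), (0 < N)%N -> 0 < r0 -> uniq s -> 0 \notin s -> exists J,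
   weighted_sum N s <= C * ((isqrt R N)%:R `^ (- r) * \sum_(j < J | 2 ^+ j <= r0) (2 ^+ j) `^ (sigma * r - 2 * delta)
      + r0 `^ (- (2 * delta - d%:R))).
Proof.
(* The kernel occurs squared, so its decay at exponent tau yields the exponent 2 tau = r + 1 of
   [sum_level_dioph]. *)
move=> r1; pose tau := (r + 1) / 2; have tau0 : 0 < tau by rewrite divr_gt0 //; lra.
pose K : R := expR (tau ^+ 2 / 4).
pose C1 : R := K ^+ 2 * (2 * (H `^ (- r) * (d%:R * 4) `^ (sigma * r))).
pose C2 : R := 4 ^+ d * (1 - 2 `^ (- (2 * delta - d%:R)))^-1.
have C10 : 0 <= C1 by rewrite mulr_ge0 ?sqr_ge0 // mulr_ge0 // mulr_ge0 // powR_ge0.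
have C20 : 0 <= C2.
  rewrite mulr_ge0 ?exprn_ge0 // invr_ge0 subr_ge0 powRN invf_le1 ?powR_gt0 //.
  by apply: ltW; exact: powR2_gt1.
exists (C1 + C2); first exact: addr_ge0.
move=> N s r0 N0 r00 us s0.
have M0 : 0 < (isqrt R N)%:R :> R by rewrite ltr0n isqrt_gt0.
set M := (isqrt R N)%:R in M0 *.
pose F m : R := (cos (pi * dotmz m alpha) ^+ (2 * N)) ^+ 2.
pose E j : R := if 2 ^+ j <= r0 then C1 * (M `^ (- r) * (2 ^+ j) `^ (sigma * r))
                else 4 ^+ d * (2 ^+ j) `^ d%:R.
have hE t j : uniq t -> 0 \notin t -> (forall m, m \in t -> level m = j) -> \sum_(m <- t) F m <= E j.
  move=> ut t0 tj; rewrite /E; case: ifP => _.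
    rewrite /C1 -mulrA; apply: le_trans (ler_wpM2l (sqr_ge0 K) (sum_level_dioph r1 M0 ut t0 tj)).
    rewrite mulr_sumr; apply: ler_sum => m _.
    have x0 : 0 < 1 + M * dist_int (dotmz m alpha).
      by rewrite ltr_wpDr ?ltr01 // mulr_ge0 ?dist_int_ge0 // ltW.
    have -> : - (r + 1) = - tau * 2%:R by rewrite /tau; field.
    rewrite powRrM powR_mulrn ?powR_ge0 // -exprMn lerXn2r ?nnegrE ?cos_pow_ge0 //.
      by rewrite mulr_ge0 ?powR_ge0 ?expR_ge0.
    exact: cos_pow_le.
  apply: le_trans (size_level_le R ut t0 tj).
  rewrite -sum1_size natr_sum; apply: ler_sum => m _.
  by rewrite /F exprn_ile1 ?cos_pow_ge0 // exprM exprn_ile1 ?sqr_ge0 // -(cos2Dsin2 (pi * dotmz m alpha)) lerDl sqr_ge0.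
have [J hJ] := sum_level_le (ltW delta_gt0) us s0 (fun m => sqr_ge0 _) hE.
exists J; apply: le_trans hJ _.
rewrite (bigID (fun j : 'I_J => 2 ^+ j <= r0)) /= [leRHS]mulrDl.
set S := \sum_(j < J | _) (2 ^+ j) `^ (_ - _).
have S0 : 0 <= M `^ (- r) * S by rewrite mulr_ge0 ?powR_ge0 // sumr_ge0 // => j _; exact: powR_ge0.
have T0 := powR_ge0 r0 (- (2 * delta - d%:R)).
have h1 : \sum_(j < J | 2 ^+ j <= r0) (2 ^+ j) `^ (- (2 * delta)) * E j <= C1 * (M `^ (- r) * S).
  rewrite !mulr_sumr; apply: ler_sum => j jr; rewrite /E jr.
  rewrite (addrC (sigma * r)) powRDp ?exprn_gt0 // le_eqVlt; apply/orP; left; apply/eqP; ring.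
have h2 : \sum_(j < J | ~~ (2 ^+ j <= r0)) (2 ^+ j) `^ (- (2 * delta)) * E j <= C2 * r0 `^ (- (2 * delta - d%:R)).
  rewrite /C2 -mulrA; apply: le_trans (ler_wpM2l _ (geometric_down J r00 gap_gt0)); last by rewrite exprn_ge0.
  rewrite mulr_sumr (eq_bigl (fun j : 'I_J => r0 < 2 ^+ j)) => [|j]; last by rewrite -ltNge.
  apply: ler_sum => j jr; rewrite /E (_ : (2 ^+ j <= r0) = false); last by rewrite leNgt jr.
  by rewrite opprB addrC powRDp ?exprn_gt0 // le_eqVlt; apply/orP; left; apply/eqP; ring.
have := lerD h1 h2; have := mulr_ge0 C10 T0; have := mulr_ge0 C20 S0; lra.
Qed.

(** T lives on the squared scale, before the square root of Cauchy-Schwarz is taken. *)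
Definition majorized (T : R -> R) := exists2 C, 0 <= C &
  forall N s, (0 < N)%N -> uniq s -> 0 \notin s -> weighted_sum N s <= C * T (isqrt R N)%:R.

Let isqrt_ge1 N : (0 < N)%N -> 1 <= (isqrt R N)%:R :> R.
Proof. by move=> N0; rewrite ler1n isqrt_gt0. Qed.

Lemma majorizedW (T T' : R -> R) (c : R) : 0 <= c -> (forall M, 1 <= M -> T M <= c * T' M) ->
  majorized T -> majorized T'.
Proof.
move=> c0 TT [C C0 hC]; exists (C * c); first exact: mulr_ge0.
move=> N s N0 us s0; apply: le_trans (hC _ _ N0 us s0) _.
by rewrite -mulrA ler_wpM2l // TT // isqrt_ge1.
Qed.

Lemma majorized_subcritical : 2 * delta < sigma ->
  majorized (fun M => M `^ (- ((2 * delta - d%:R) / (sigma - d%:R)))).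
Proof.
move=> ds; have sd : 0 < sigma - d%:R by have := gap_gt0; lra.
have [C C0 hC] := weighted_sum_split (lexx 1).
have e0 : 0 < sigma - 2 * delta by lra.
pose q : R := 2 `^ (sigma - 2 * delta) / (2 `^ (sigma - 2 * delta) - 1).
have q0 : 0 <= q by have := powR2_gt1 e0; rewrite /q => q1; rewrite divr_ge0 ?powR_ge0 //; lra.
exists (C * (q + 1)); first by rewrite mulr_ge0 // addr_ge0.
move=> N s N0 us s0; have M1 := isqrt_ge1 N0; set M := (isqrt R N)%:R in M1 *.
have M0 : 0 < M by lra.
(* This threshold balances M^-1 r0^(sigma - 2 delta), dominated by the last shells below r0, against
   the tail r0^-(2 delta - d). *)
have [J] := hC N s (M `^ (sigma - d%:R)^-1) N0 (powR_gt0 _ M0) us s0.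
rewrite -/M mulr1 => h; apply: le_trans h _; rewrite -mulrA ler_wpM2l // [leRHS]mulrDl mul1r.
rewrite -powRrM (_ : (sigma - d%:R)^-1 * - (2 * delta - d%:R) = - ((2 * delta - d%:R) / (sigma - d%:R))); last by ring.
rewrite lerD2r.
apply: le_trans (ler_wpM2l (powR_ge0 _ _) (geometric_up J (powR_gt0 _ M0) e0)) _.
rewrite mulrCA -/q ler_wpM2l // -powRrM -powRDp //.
rewrite (_ : -1 + _ = - ((2 * delta - d%:R) / (sigma - d%:R))) //.
by field; rewrite gt_eqF.
Qed.

(** The sum over low shells now converges and costs a constant; the threshold M^(r/(2 delta - d))
    only has to make the tail equal to M^-r. *)
Lemma majorized_supercritical (r : R) : 1 <= r -> sigma * r < 2 * delta -> majorized (fun M => M `^ (- r)).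
Proof.
move=> r1 rd; have [C C0 hC] := weighted_sum_split r1.
have e0 : 0 < 2 * delta - sigma * r by lra.
pose q : R := (1 - 2 `^ (- (2 * delta - sigma * r)))^-1 * 2 `^ (2 * delta - sigma * r).
have q0 : 0 <= q.
  rewrite mulr_ge0 ?powR_ge0 // invr_ge0 subr_ge0 powRN invf_le1 ?powR_gt0 //.
  by apply: ltW; exact: powR2_gt1.
exists (C * (q + 1)); first by rewrite mulr_ge0 // addr_ge0.
move=> N s N0 us s0; have M1 := isqrt_ge1 N0; set M := (isqrt R N)%:R in M1 *.
have M0 : 0 < M by lra.
have [J] := hC N s (M `^ (r / (2 * delta - d%:R))) N0 (powR_gt0 _ M0) us s0.
rewrite -/M => h; apply: le_trans h _; rewrite -mulrA ler_wpM2l // [leRHS]mulrDl mul1r.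
rewrite -powRrM (_ : r / (2 * delta - d%:R) * - (2 * delta - d%:R) = - r); last first.
  by field; rewrite gt_eqF.
rewrite lerD2r mulrC ler_wpM2r ?powR_ge0 //.
apply: le_trans (geometric_total J e0); rewrite big_mkcond; apply: ler_sum => j _.
by rewrite opprB; case: ifP => // _; exact: powR_ge0.
Qed.

Lemma ln_ge_ln2 (M : R) : 1 <= M -> ln 2 <= ln (1 + M).
Proof. by move=> M1; rewrite ler_ln ?posrE //; lra. Qed.

Lemma ln2_gt0 : 0 < ln (2 : R).
Proof. by rewrite ln_gt0 // ltr1n. Qed.

(** All low shells contribute equally, so their number, logarithmic in the threshold M^g, produces
    the factor ln(1 + M). *)
Lemma majorized_critical (r : R) : 1 <= r -> sigma * r = 2 * delta ->
  majorized (fun M => M `^ (- r) * ln (1 + M)).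
Proof.
move=> r1 rd; have [C C0 hC] := weighted_sum_split r1.
have l2 := ln2_gt0.
pose g := r / (2 * delta - d%:R); have g0 : 0 <= g by rewrite divr_ge0 ?(ltW gap_gt0) //; lra.
exists (C * ((2 + g) / ln 2)); first by rewrite mulr_ge0 // divr_ge0 ?(ltW l2) // addr_ge0.
move=> N s N0 us s0; have M1 := isqrt_ge1 N0; set M := (isqrt R N)%:R in M1 *.
have M0 : 0 < M by lra.
have [J] := hC N s (M `^ g) N0 (powR_gt0 _ M0) us s0.
rewrite -/M => h; apply: le_trans h _; rewrite -mulrA ler_wpM2l //.
rewrite -powRrM (_ : g * - (2 * delta - d%:R) = - r); last by rewrite /g; field; rewrite gt_eqF.
rewrite -[X in _ + X]mulr1 -mulrDr mulrCA ler_wpM2l ?powR_ge0 // rd subrr.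
under eq_bigr do rewrite powRr0.
have Mg : 1 <= M `^ g by rewrite -(powRr0 M) ler_powR.
apply: (@le_trans _ _ (1 + ln (M `^ g) / ln 2 + 1)); first by rewrite lerD2r; exact: count_pow2.
rewrite ln_powR [leRHS]mulrAC ler_pdivlMr //.
have -> : (1 + g * ln M / ln 2 + 1) * ln 2 = 2 * ln 2 + g * ln M by field; rewrite gt_eqF.
have lM : ln M <= ln (1 + M) by rewrite ler_ln ?posrE //; lra.
have l3 := ln_ge_ln2 M1; have := ler_wpM2l g0 lM; lra.
Qed.

End Weighted.
End Diophantine.

(** * Diophantine vectors: comparison with X and the discrepancy bound *)

Section PartB.
Variables (R : realType) (d : nat).
Implicit Types (s : seq 'rV[int]_d).

Lemma weighted_sum_anti (alpha : 'rV[R]_d) (delta delta' : R) N s : delta' <= delta ->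
  weighted_sum alpha delta N s <= weighted_sum alpha delta' N s.
Proof.
move=> dd; apply: ler_sum => m _; apply: ler_wpM2r; first exact: sqr_ge0.
by apply: ler_powR; [rewrite lerDl sqr_ge0 | rewrite lerN2].
Qed.

Lemma majorized_delta (alpha : 'rV[R]_d) (delta delta' : R) T : delta' <= delta ->
  majorized alpha delta' T -> majorized alpha delta T.
Proof.
move=> dd [C C0 hC]; exists C => // N s N0 us s0.
exact: le_trans (weighted_sum_anti _ _ _ dd) (hC _ _ N0 us s0).
Qed.

(** [X] with a real last argument, so that it can be fed to [majorized]. *)
Definition Xr (delta theta sigma M : R) : R :=
  let D : R := d%:R in
  let L : R := ln (1 + M) in
  if theta < 2^-1 then
    let crit := theta * sigma - D * (theta - 2^-1) in
    if delta < crit then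
      M `^ ((- delta + theta * sigma - D * theta + D / 2) / (sigma - D))
    else if delta == crit then L `^ 2^-1
    else 1
  else if theta == 2^-1 then
    if delta < sigma / 2 then
      M `^ ((sigma / 2 - delta) / (sigma - D)) * L `^ 2^-1
    else if delta == sigma / 2 then L
    else 1
  else
    if delta < theta * sigma then
      M `^ (theta * (theta * sigma - delta) / (theta * sigma - D / 2))
    else if delta == theta * sigma then L `^ 2^-1
    else 1.

Lemma powR_half_sq (x : R) : 0 <= x -> (x `^ 2^-1) ^+ 2 = x.
Proof. by move=> x0; rewrite -powR_mulrn ?powR_ge0 // -powRrM mulVf ?powRr1. Qed.

Lemma powR_sq (x e : R) : (x `^ e) ^+ 2 = x `^ (2 * e).
Proof. by rewrite -powR_mulrn ?powR_ge0 // -powRrM mulrC. Qed.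

Section Fixed.
Variables (alpha : 'rV[R]_d) (H sigma delta theta : R).
Hypothesis d_gt0 : (0 < d)%N.
Hypothesis H_gt0 : 0 < H.
Hypothesis sigma_ge : d%:R <= sigma.
Hypothesis dioph : forall m : 'rV[int]_d, m != 0 ->
  H * enormz R m `^ (- sigma) <= dist_int (dotmz m alpha).
Hypothesis delta_gt : d%:R / 2 < delta.
Hypothesis theta_gt0 : 0 < theta.

Let X2 (M : R) := M `^ (- (2 * theta)) * Xr delta theta sigma M ^+ 2.

Let dR : 0 < d%:R :> R. Proof. by rewrite ltr0n. Qed.

Let log_ge (M : R) : 1 <= M -> 1 <= (ln 2)^-1 * ln (1 + M).
Proof.
move=> M1; have l2 := ln2_gt0 R.
by rewrite mulrC ler_pdivlMr // mul1r; exact: ln_ge_ln2.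
Qed.

Let pow_cmp (M e y : R) : 1 <= M -> 2 * theta <= e + y -> M `^ (- e) <= M `^ (- (2 * theta)) * M `^ y.
Proof. by move=> M1 h; rewrite -powRDp; [apply: ler_powR => //; lra | lra]. Qed.

Lemma majorized_X_theta_lt : theta < 2^-1 -> majorized alpha delta X2.
Proof.
move=> th; set crit := theta * sigma - d%:R * (theta - 2^-1).
have sub := majorized_subcritical d_gt0 H_gt0 sigma_ge dioph.
(* So [crit] is the value of delta at which the subcritical exponent equals 2 theta; as theta < 1/2,
   it is at most sigma/2. *)
have critE : 2 * crit - d%:R = 2 * theta * (sigma - d%:R) by rewrite /crit; field.
have [ds|sd] := ltP (2 * delta) sigma.
  have sd : 0 < sigma - d%:R by have := delta_gt; lra.
  have := sub _ delta_gt ds; set e := (_ / _) => he.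
  have eE : 2 * delta = e * (sigma - d%:R) + d%:R by rewrite /e mulfVK ?gt_eqF // subrK.
  rewrite /X2 /Xr th -/crit; have [dc|cd] := ltP delta crit.
    apply: majorizedW he; [exact: ler01|move=> M M1]; rewrite mul1r powR_sq; apply: pow_cmp => //.
    rewrite le_eqVlt; apply/orP; left; apply/eqP.
    by rewrite /e; field; rewrite gt_eqF.
  have e2 : 2 * theta <= e.
    by rewrite -(ler_pM2r sd) -critE; have := eE; lra.
  case: eqP => [dc|_].
    apply: (@majorizedW _ _ _ _ _ _ (ln 2)^-1) he; first by rewrite invr_ge0 ltW // ln2_gt0.
    move=> M M1; have l0 : 0 <= ln (1 + M) by apply: ln_ge0; lra.
    rewrite powR_half_sq // mulrCA; apply: (@le_trans _ _ (M `^ (- (2 * theta)) * 1)).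
      by rewrite mulr1; apply: ler_powR => //; lra.
    by apply: ler_wpM2l; [exact: powR_ge0 | exact: log_ge].
  apply: (majorizedW ler01) he => M M1; rewrite expr1n mulr1 mul1r.
  by apply: ler_powR => //; lra.
have cd : crit <= delta.
  have : 2 * theta * (sigma - d%:R) <= 1 * (sigma - d%:R).
    by rewrite ler_wpM2r ?subr_ge0 //; lra.
  by have := critE; lra.
have X1 : (Xr delta theta sigma = fun=> 1) \/ delta = crit.
  rewrite /Xr th -/crit ltNge cd /=; case: eqP => [|_]; [by right|by left].
have cs : majorized alpha delta (fun M => M `^ (- (2 * theta))).
  have [sd'|ds] := ltP sigma (2 * delta).
    have := @majorized_supercritical R d alpha H sigma d_gt0 H_gt0 sigma_ge dioph delta delta_gt 1 (lexx _).
    rewrite mulr1 => /(_ sd'); apply: (majorizedW ler01) => M M1; rewrite mul1r.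
    by apply: ler_powR => //; lra.
  (* Here 2 delta = sigma, where the critical estimate would give M^-1 ln(1 + M). Lowering delta to
     [crit], which is subcritical, gives M^(-2 theta) directly. *)
  have sd2 : sigma - d%:R > 0 by have := delta_gt; lra.
  have cr : d%:R / 2 < crit.
    have : 0 < 2 * theta * (sigma - d%:R) by rewrite !mulr_gt0.
    by have := critE; lra.
  have c2 : 2 * crit < sigma.
    have : 2 * theta * (sigma - d%:R) < 1 * (sigma - d%:R) by rewrite ltr_pM2r //; lra.
    by have := critE; lra.
  apply: majorized_delta cd _; have := sub _ cr c2.
  by rewrite critE mulfK // gt_eqF.
case: X1 => [X1|dc].
  apply: (majorizedW ler01) cs => M M1; rewrite /X2 X1 expr1n mulr1 mul1r.
  exact: lexx.
apply: (@majorizedW _ _ _ _ _ _ (ln 2)^-1) cs; first by rewrite invr_ge0 ltW // ln2_gt0.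
move=> M M1; have l0 : 0 <= ln (1 + M) by apply: ln_ge0; lra.
rewrite /X2 /Xr th -/crit dc ltxx eqxx powR_half_sq // mulrCA.
by rewrite -[leLHS]mulr1 ler_wpM2l ?powR_ge0 // log_ge.
Qed.

(** Since 2 theta = 1, the three regimes of [X] are the three estimates above at r = 1. *)
Lemma majorized_X_theta_eq : theta = 2^-1 -> majorized alpha delta X2.
Proof.
move=> th; have t2 : 2 * theta = 1 by rewrite th divff.
rewrite /X2 /Xr t2 th ltxx eqxx.
have l0 (M : R) : 1 <= M -> 0 <= ln (1 + M) by move=> M1; apply: ln_ge0; lra.
have il : 0 <= (ln 2)^-1 :> R by rewrite invr_ge0 ltW // ln2_gt0.
have [ds|] := ltP delta (sigma / 2).
  have ds2 : 2 * delta < sigma by lra.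
  have sd : 0 < sigma - d%:R by have := delta_gt; lra.
  have := majorized_subcritical d_gt0 H_gt0 sigma_ge dioph delta_gt ds2.
  apply: (majorizedW il) => M M1; rewrite exprMn powR_sq powR_half_sq ?l0 //.
  rewrite [X in _ <= _ * X]mulrA -powRDp; last by lra.
  rewrite (_ : -1 + _ = - ((2 * delta - d%:R) / (sigma - d%:R))); last by field; rewrite gt_eqF.
  by rewrite mulrCA -[leLHS]mulr1 ler_wpM2l ?powR_ge0 // log_ge.
case: eqP => [ds _|nds sd].
  have ds2 : sigma * 1 = 2 * delta by rewrite ds; field.
  have := majorized_critical d_gt0 H_gt0 sigma_ge dioph delta_gt (lexx 1) ds2.
  apply: (majorizedW il) => M M1; rewrite expr2 mulrCA; apply: ler_wpM2l; first exact: powR_ge0.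
  by rewrite mulrA -[leLHS]mul1r ler_wpM2r ?l0 ?log_ge.
have ds2 : sigma * 1 < 2 * delta.
  by rewrite mulr1 ltNge; apply/negP => h; apply: nds; lra.
have := majorized_supercritical d_gt0 H_gt0 sigma_ge dioph delta_gt (lexx 1) ds2.
by apply: (majorizedW ler01) => M M1; rewrite expr1n mulr1 mul1r.
Qed.

Lemma majorized_X_theta_gt : 2^-1 < theta -> majorized alpha delta X2.
Proof.
move=> th; rewrite /X2 /Xr.
have -> : (theta < 2^-1) = false by apply/negbTE; rewrite -leNgt ltW.
have -> : (theta == 2^-1) = false by rewrite gt_eqF.
have t2 : 1 <= 2 * theta by lra.
have sg0 : 0 < sigma by exact: lt_le_trans sigma_ge.
have ths : sigma < 2 * theta * sigma by rewrite -[ltLHS]mul1r ltr_pM2r //; lra.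
have [dts|] := ltP delta (theta * sigma); last first.
  case: eqP => [dts _|ndts tsd].
    have E : sigma * (2 * theta) = 2 * delta by rewrite dts; ring.
    have := majorized_critical d_gt0 H_gt0 sigma_ge dioph delta_gt t2 E.
    apply: (majorizedW ler01) => M M1; rewrite mul1r powR_half_sq //.
    by apply: ln_ge0; lra.
  have E : sigma * (2 * theta) < 2 * delta.
    rewrite ltNge; apply/negP => h; apply: ndts; lra.
  have := majorized_supercritical d_gt0 H_gt0 sigma_ge dioph delta_gt t2 E.
  by apply: (majorizedW ler01) => M M1; rewrite expr1n mulr1 mul1r.
have g0 : 0 < theta * sigma - d%:R / 2 by have := sigma_ge; lra.
(* The decay exponent of the target: affine in delta, equal to 0 at delta = d/2 and to 2 theta at
   delta = theta sigma. *)
pose e := theta * (2 * delta - d%:R) / (theta * sigma - d%:R / 2).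
have eE : theta * (2 * delta - d%:R) = e * (theta * sigma - d%:R / 2) by rewrite /e mulfVK // gt_eqF.
have gap : 0 < 2 * delta - d%:R by have := delta_gt; lra.
have e0 : 0 < e by rewrite divr_gt0 // mulr_gt0.
have XE M : 1 <= M -> M `^ (- e) =
    M `^ (- (2 * theta)) * (M `^ (theta * (theta * sigma - delta) / (theta * sigma - d%:R / 2))) ^+ 2.
  move=> M1; rewrite powR_sq -powRDp; last by lra.
  by congr powR; rewrite /e; field; apply: lt0r_neq0; lra.
(* For 2 delta <= sigma the decay M^-e is the subcritical one at the smaller
   exponent delta' solving (2 delta' - d) / (sigma - d) = e. *)
suff : majorized alpha delta (fun M => M `^ (- e)).
  by apply: (majorizedW ler01) => M M1; rewrite mul1r XE.
have [sd|ds] := ltP sigma (2 * delta).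
  (* Both candidates are admissible: sigma < 2 delta by the case at hand, and sigma e < 2 delta
     amounts to delta < theta sigma. *)
  pose r := Num.max 1 e.
  have r1 : 1 <= r by rewrite le_max lexx.
  have rs : sigma * r < 2 * delta.
    rewrite /r maxEle; case: ifP => _; last by rewrite mulr1.
    rewrite -(ltr_pM2r g0) -mulrA -eE.
    have : 0 < d%:R * (theta * sigma - delta) by rewrite mulr_gt0 //; lra.
    lra.
  have := majorized_supercritical d_gt0 H_gt0 sigma_ge dioph delta_gt r1 rs.
  apply: (majorizedW ler01) => M M1; rewrite mul1r; apply: ler_powR => //.
  by rewrite lerN2 le_max lexx orbT.
have sd : 0 < sigma - d%:R by lra.
pose delta' := (e * (sigma - d%:R) + d%:R) / 2.
have h1 : d%:R / 2 < delta' by have := mulr_gt0 e0 sd; rewrite /delta'; lra.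
have h2 : delta' <= delta.
  (* By the value of e this reads theta (sigma - d) <= theta sigma - d/2, that is theta >= 1/2. *)
  suff : e * (sigma - d%:R) <= 2 * delta - d%:R by rewrite /delta'; lra.
  rewrite -(ler_pM2r g0) mulrAC -eE -mulrA mulrC -[leLHS]mulrA; apply: ler_wpM2l; first exact: ltW.
  have : 1 * d%:R <= 2 * theta * d%:R by rewrite ler_pM2r.
  lra.
have h3 : 2 * delta' < sigma.
  suff e1 : e < 1.
    have : e * (sigma - d%:R) < 1 * (sigma - d%:R) by rewrite ltr_pM2r.
    by rewrite /delta'; lra.
  rewrite -(ltr_pM2r g0) -eE mul1r.
  have : theta * (2 * delta) <= theta * sigma by rewrite ler_pM2l.
  have : 0 < (theta - 2^-1) * d%:R by rewrite mulr_gt0 //; lra.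
  lra.
apply: majorized_delta h2 _.
have := majorized_subcritical d_gt0 H_gt0 sigma_ge dioph h1 h3.
rewrite (_ : (2 * delta' - d%:R) / (sigma - d%:R) = e) //.
by rewrite /delta'; field; rewrite gt_eqF.
Qed.

Lemma majorized_X : majorized alpha delta X2.
Proof.
have [h|h|h] := ltgtP theta 2^-1.
- exact: majorized_X_theta_lt.
- exact: majorized_X_theta_gt.
- exact: majorized_X_theta_eq.
Qed.

End Fixed.

Lemma cauchy_schwarz (I : Type) (s : seq I) (a b : I -> R) :
  \sum_(i <- s) a i * b i <=
  Num.sqrt (\sum_(i <- s) a i ^+ 2) * Num.sqrt (\sum_(i <- s) b i ^+ 2).
Proof.
elim: s => [|i s IH]; first by rewrite !big_nil sqrtr0 mulr0.
rewrite !big_cons.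
set P := \sum_(j <- s) a j ^+ 2 in IH *; set Q := \sum_(j <- s) b j ^+ 2 in IH *.
have P0 : 0 <= P by apply: sumr_ge0 => j _; exact: sqr_ge0.
have Q0 : 0 <= Q by apply: sumr_ge0 => j _; exact: sqr_ge0.
rewrite -{1}(sqr_sqrtr P0) -{1}(sqr_sqrtr Q0).
move: (Num.sqrt P) (Num.sqrt Q) (a i) (b i) IH => p q x y IH.
apply: (@le_trans _ _ (x * y + p * q)); first by rewrite lerD2l.
rewrite -sqrtrM ?addr_ge0 ?sqr_ge0 //.
apply: le_trans (ler_norm _) _; rewrite -sqrtr_sqr ler_wsqrtr //.
rewrite -subr_ge0 (_ : _ - _ = (x * q - p * y) ^+ 2) ?sqr_ge0 //; ring.
Qed.

(** A is the squared norm; afterwards the infinite sum is used only through its finite subsums. *)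
Lemma sobolev_norm_fin (delta : R) (f : 'rV[R]_d -> R[i]) : (sobolev_norm delta f < +oo)%E ->
  exists2 A : R, 0 <= A & (sobolev_norm delta f = (Num.sqrt A)%:E)%E /\
    forall s, uniq s ->
      \sum_(m <- s) (1 + enormz R m ^+ 2) `^ delta * Normc.normc (fourier_coef f m) ^+ 2 <= A.
Proof.
rewrite /sobolev_norm; set g := (fun m => _%:E); set E := (\esum_(m in _) _)%E.
have g0 m : (0 <= g m)%E by rewrite lee_fin mulr_ge0 ?powR_ge0 ?sqr_ge0.
have E0 : (0 <= E)%E by apply: esum_ge0 => m _; exact: g0.
have hE s : uniq s ->
   ((\sum_(m <- s) (1 + enormz R m ^+ 2) `^ delta * Normc.normc (fourier_coef f m) ^+ 2)%:E <= E)%E.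
  move=> us; rewrite -sumEFin; apply: esum_ge; exists [set` s].
    by split => //; exact: finite_seq.
  by rewrite fsbig_seq.
move: E E0 hE => [A| |] // A0 hE; last by rewrite poweRyr // gt_eqF // invr_gt0.
rewrite poweR_EFin powR12_sqrt ?lee_fin // => _; exists A; first by rewrite -lee_fin.
by split=> // s us; rewrite -lee_fin; exact: hE.
Qed.

Lemma powN_le_isqrt (theta : R) N : 0 <= theta -> (0 < N)%N ->
  (isqrt R N)%:R `^ (- theta) <= 2 `^ theta * N%:R `^ (- (theta / 2)).
Proof.
move=> th N0; have M0 : 0 < (isqrt R N)%:R :> R by rewrite ltr0n isqrt_gt0.
rewrite (_ : - (theta / 2) = 2^-1 * - theta); last by field.
rewrite powRrM powR12_sqrt // -[leLHS]mul1r -ler_pdivrMl ?powR_gt0 //.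
rewrite mul1r -powRN -powRM ?(ltW M0) //; apply: powR_le_anti => //.
  by rewrite sqrtr_gt0 ltr0n.
exact: sqrt_le_isqrt.
Qed.

Lemma sup_norm_le (f : 'rV[R]_d -> R[i]) (B : R) : (forall x, Normc.normc (f x) <= B) ->
  (sup_norm f <= B%:E)%E.
Proof. by move=> h; apply: ge_ereal_sup => _ [x _ <-]; rewrite lee_fin. Qed.

Theorem discrepancy_diophantine (alpha : 'rV[R]_d) (H sigma delta theta : R) :
  (0 < d)%N -> 0 < theta -> 0 < H -> d%:R <= sigma ->
  (forall m : 'rV[int]_d, m != 0 ->
       H * enormz R m `^ (- sigma) <= dist_int (dotmz m alpha)) ->
  d%:R / 2 < delta ->
  exists2 c : R, 0 < c &
    forall (f : 'rV[R]_d -> R[i]) (N : nat), sobolev delta f -> (0 < N)%N ->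
      (sup_norm (discrepancy (@Phi R) N alpha f) <=
       (c * N%:R `^ (- (theta / 2)) *
        X d delta theta sigma (isqrt R N))%:E * sobolev_norm delta f)%E.
Proof.
move=> d0 th H0 sd dioph dd.
have [C C0 hC] := majorized_X d0 H0 sd dioph dd th.
exists (Num.sqrt C * 2 `^ theta + 1); first by rewrite ltr_wpDl // mulr_ge0 ?sqrtr_ge0 ?powR_ge0.
move=> f N [cf pf nf] N0; have [A A0 [-> hA]] := sobolev_norm_fin nf.
rewrite -EFinM; apply: sup_norm_le => x; apply: discrepancy_le => // s us s0.
set M : R := (isqrt R N)%:R.
have XE : X d delta theta sigma (isqrt R N) = Xr delta theta sigma M by [].
have M1 : 1 <= M by rewrite ler1n isqrt_gt0.
have X0 : 0 <= Xr delta theta sigma M.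
  have l0 : 0 <= ln (1 + M) by apply: ln_ge0; lra.
  by rewrite /Xr; do ![case: ifP => _]; rewrite ?mulr_ge0 ?powR_ge0.
pose w (m : 'rV[int]_d) : R := 1 + enormz R m ^+ 2.
have w0 m : 0 < w m by rewrite ltr_wpDr ?sqr_ge0.
have := hA s us; have := hC N s N0 us s0; rewrite -/M => h1 h2.
apply: (@le_trans _ _ (Num.sqrt A * Num.sqrt (C * (M `^ (- (2 * theta)) * Xr delta theta sigma M ^+ 2)))).
  (* The weights w^(delta/2) and w^(-delta/2) cancel in the product; squared, they give the Sobolev
     norm and [weighted_sum]. *)
  have := cauchy_schwarz s (fun m => w m `^ (delta / 2) * Normc.normc (fourier_coef f m))
    (fun m => w m `^ (- (delta / 2)) * cos (pi * dotmz m alpha) ^+ (2 * N)).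
  rewrite (eq_bigr (fun m => Normc.normc (fourier_coef f m) * cos (pi * dotmz m alpha) ^+ (2 * N))); last first.
    move=> m _; rewrite mulrACA powRN mulfV ?mul1r //.
    by rewrite gt_eqF // powR_gt0.
  move=> /le_trans; apply; apply: ler_pM; rewrite ?sqrtr_ge0 // ler_wsqrtr //.
    apply: le_trans h2; apply: ler_sum => m _; rewrite exprMn powR_sq.
    by rewrite (_ : 2 * (delta / 2) = delta) //; field.
  apply: le_trans h1; apply: ler_sum => m _; rewrite exprMn powR_sq.
  by rewrite (_ : 2 * - (delta / 2) = - delta) //; field.
rewrite sqrtrM // (_ : _ * _ ^+ 2 = (M `^ (- theta) * Xr delta theta sigma M) ^+ 2); last first.
  by rewrite exprMn powR_sq; congr (_ `^ _ * _); ring.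
rewrite sqrtr_sqr ger0_norm ?mulr_ge0 ?powR_ge0 // XE [leRHS]mulrC ler_wpM2l ?sqrtr_ge0 //.
rewrite mulrA ler_wpM2r //.
apply: (@le_trans _ _ (Num.sqrt C * (2 `^ theta * N%:R `^ (- (theta / 2))))).
  by rewrite ler_wpM2l ?sqrtr_ge0 // powN_le_isqrt // ltW.
by rewrite mulrA ler_wpM2r ?powR_ge0 // lerDl.
Qed.

End PartB.

(** * Almost every vector *)

Section PartA.
Variables (R : realType) (d : nat).
Notation mR := (measurableTypeR R).
Local Notation mud := (lebesgue_tuple R d).
Local Notation row := (@row_of_tuple R d).
Implicit Types (s : seq 'rV[int]_d) (m : 'rV[int]_d).

Lemma nneseries_le (u : nat -> \bar R) (x : \bar R) : (forall n, 0 <= u n)%E ->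
  (forall K, \sum_(0 <= k < K) u k <= x)%E -> (\sum_(0 <= k <oo) u k <= x)%E.
Proof.
move=> u0 hx; apply: lime_le; first by apply: is_cvg_nneseries => n _ _; exact: u0.
by apply: nearW => n; exact: hx.
Qed.

Lemma seq_le_nneseries (u : nat -> \bar R) (t : seq nat) : (forall n, 0 <= u n)%E -> uniq t ->
  (\sum_(k <- t) u k <= \sum_(0 <= k <oo) u k)%E.
Proof.
move=> u0 ut; rewrite nneseries_esumT //; apply: esum_ge; exists [set` t].
  by split => //; exact: finite_seq.
by rewrite fsbig_seq.
Qed.

(** * A double series over frequencies and scales, finite almost everywhere *)

Section SeriesBound.
Variables (c : 'rV[int]_d -> R) (gam : nat -> R) (nk : nat -> nat) (B B' : R).
Hypothesis c_ge0 : forall m, 0 <= c m.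
Hypothesis gam_ge0 : forall k, 0 <= gam k.
Hypothesis c_sum : forall s, uniq s -> 0 \notin s -> \sum_(m <- s) c m <= B.
Hypothesis gam_sum : forall K, \sum_(0 <= k < K) gam k * Phi R (nk k) 0 <= B'.

Definition punctured m : R := if m == 0 then 0 else c m.
(** Frequencies are enumerated by their codes in nat, so that integrals can be exchanged with
    ordinary series. Integers coding no vector get coefficient 0, as does the zero frequency. *)
Definition enum_coef (i : nat) : R := oapp punctured 0 (pickle_inv i).
Definition enum_freq (i : nat) : 'rV[int]_d := odflt 0 (pickle_inv i).
Definition series_term (i k : nat) (t : d.-tuple mR) : R :=
  enum_coef i * (gam k * cos (pi * dotmz (enum_freq i) (row t)) ^+ (2 * nk k)).
Definition series_sum (t : d.-tuple mR) : \bar R := (\sum_(0 <= i <oo) \sum_(0 <= k <oo) (series_term i k t)%:E)%E.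

Fact enum_coef_ge0 i : 0 <= enum_coef i.
Proof. by rewrite /enum_coef; case: pickle_inv => //= m; rewrite /punctured; case: ifP. Qed.

Fact series_term_ge0 i k t : (0 <= (series_term i k t)%:E)%E.
Proof. by rewrite lee_fin mulr_ge0 ?enum_coef_ge0 // mulr_ge0 // cos_pow_ge0. Qed.

Fact series_row_ge0 i t : (0 <= \sum_(0 <= k <oo) (series_term i k t)%:E)%E.
Proof. by apply: nneseries_ge0 => k _ _; exact: series_term_ge0. Qed.

Fact gam_bound_ge0 : 0 <= B'.
Proof. by have := gam_sum 0; rewrite big_geq. Qed.

Fact enum_coef_sum K : \sum_(0 <= i < K) enum_coef i <= B.
Proof.
rewrite (_ : \sum_(0 <= i < K) enum_coef i = \sum_(m <- pmap pickle_inv (index_iota 0 K)) punctured m); last by rewrite big_pmap.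
have us : uniq (pmap (@pickle_inv 'rV[int]_d) (index_iota 0 K)).
  by apply: (pmap_uniq (@pickle_invK 'rV[int]_d)); exact: iota_uniq.
move: (pmap _ _) us => s us.
rewrite (_ : \sum_(m <- s) punctured m = \sum_(m <- [seq m <- s | m != 0]) c m); last first.
  by rewrite big_filter [RHS]big_mkcond /=; apply: eq_bigr => m _; rewrite /punctured; case: eqP.
by apply: c_sum; [rewrite filter_uniq | rewrite mem_filter eqxx].
Qed.

Fact measurable_series_term i k : measurable_fun [set: d.-tuple mR] (fun t => (series_term i k t)%:E).
Proof.
apply/measurable_EFinP; apply: measurable_funM => //; apply: measurable_funM => //.
have := @measurable_cos_pow_form R d (fun j => (enum_freq i 0 j)%:~R) 0 (2 * nk k).
congr measurable_fun; apply/funext => t; rewrite addr0 /dotmz.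
by congr (cos (pi * _) ^+ _); apply: eq_bigr => j _; rewrite mxE.
Qed.

Fact measurable_series_row i : measurable_fun [set: d.-tuple mR] (fun t => \sum_(0 <= k <oo) (series_term i k t)%:E)%E.
Proof.
apply: (@ge0_emeasurable_sum _ _ _ _ (fun k t => (series_term i k t)%:E) xpredT) => [k t _ _|k _].
  exact: series_term_ge0.
exact: measurable_series_term.
Qed.

Fact integral_series_term (n i k : nat) :
  (\int[mud]_(t in box (- n.+1%:R) (n.+1%:R) d) (series_term i k t)%:E =
   (enum_coef i * (gam k * Phi R (nk k) 0) * (n.+1%:R - - n.+1%:R) ^+ d)%:E)%E.
Proof.
have nn : (- n.+1%:Z < n.+1%:Z)%R by lia.
(* A zero coefficient disposes of frequency 0, where the mean of the cosine power is 1 and not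
   [Phi R (nk k) 0]. *)
have [coef0|coef0] := eqVneq (enum_coef i) 0.
  rewrite coef0 !mul0r; apply: integral0_eq => t _; by rewrite /series_term coef0 mul0r.
have mi0 : exists j, enum_freq i 0 j != 0.
  move: coef0; rewrite /enum_coef /enum_freq; case: pickle_inv => [m|] /=; last by rewrite eqxx.
  rewrite /punctured; have [_|m0 _] := eqVneq m 0; first by rewrite eqxx.
  apply: contrapT => h; move/eqP: m0; apply; apply/rowP => j; rewrite mxE.
  by apply: contrapT => mj; apply: h; exists j; apply/eqP.
transitivity (\int[mud]_(t in box (- n.+1%:R) (n.+1%:R) d)
  ((enum_coef i * gam k)%:E * (cos (pi * (\sum_(j < d) (enum_freq i 0 j)%:~R * tnth t j + 0)) ^+ (2 * nk k))%:E))%E.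
  apply: eq_integral => t _; rewrite -EFinM /series_term mulrA addr0 /dotmz.
  by congr ((_ * cos (pi * _) ^+ _)%:E); apply: eq_bigr => j _; rewrite mxE.
rewrite ge0_integralZl_EFin //.
- have := @integral_box_cos_pow R d (enum_freq i 0) 0 (nk k) _ _ mi0 nn.
  rewrite mulrNz intrB mulrNz => ->.
  by rewrite -EFinM; congr (_%:E); rewrite !mulrA.
- exact: measurable_box.
- by move=> t _; rewrite lee_fin cos_pow_ge0.
- apply: measurable_funTS; apply/measurable_EFinP.
  exact: (@measurable_cos_pow_form R d (fun j => (enum_freq i 0 j)%:~R)).
- by rewrite mulr_ge0 // enum_coef_ge0.
Qed.

Fact integral_series_sum_lty (n : nat) : (\int[mud]_(t in box (- n.+1%:R) (n.+1%:R) d) series_sum t < +oo)%E.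
Proof.
have V0 : 0 <= (n.+1%:R - - n.+1%:R : R) ^+ d by rewrite exprn_ge0 // opprK addr_ge0.
set V := _ ^+ d in V0.
rewrite integral_nneseries; last 3 first.
- exact: measurable_box.
- by move=> i; apply: measurable_funTS; exact: measurable_series_row.
- by move=> i t _; exact: series_row_ge0.
have hi i : (\int[mud]_(t in box (- n.+1%:R) (n.+1%:R) d) \sum_(0 <= k <oo) (series_term i k t)%:E <= (enum_coef i * (B' * V))%:E)%E.
  rewrite integral_nneseries; last 3 first.
  - exact: measurable_box.
  - by move=> k; apply: measurable_funTS; exact: measurable_series_term.
  - by move=> k t _; exact: series_term_ge0.
  apply: nneseries_le => [k|K]; first by apply: integral_ge0 => t _; exact: series_term_ge0.
  under eq_bigr do rewrite integral_series_term.
  rewrite sumEFin lee_fin -mulr_suml -mulr_sumr -mulrA ler_wpM2l ?enum_coef_ge0 //.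
  by rewrite ler_wpM2r.
apply: (@le_lt_trans _ _ (B * (B' * V))%:E); last exact: ltry.
apply: nneseries_le => [i|K]; first by apply: integral_ge0 => t _; exact: series_row_ge0.
apply: le_trans (lee_sum _ (fun i _ => hi i)) _.
rewrite sumEFin lee_fin -mulr_suml ler_wpM2r ?enum_coef_sum // mulr_ge0 //.
exact: gam_bound_ge0.
Qed.

(** A finite integral over each box [-(n+1), n+1)^d gives finiteness almost everywhere on it, and
    countably many such boxes cover the space. *)
Fact ae_series_sum_lty : {ae mud, forall t : d.-tuple mR, (series_sum t < +oo)%E}.
Proof.
have G0 t : (0 <= series_sum t)%E by apply: nneseries_ge0 => i _ _; exact: series_row_ge0.
have mG : measurable_fun [set: d.-tuple mR] series_sum.
  apply: (@ge0_emeasurable_sum _ _ _ _ (fun i t => \sum_(0 <= k <oo) (series_term i k t)%:E)%E xpredT) => [i t _ _|i _].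
    exact: series_row_ge0.
  exact: measurable_series_row.
have H (n : nat) : {ae mud, forall t : d.-tuple mR, box (- n.+1%:R) (n.+1%:R) d t -> series_sum t \is a fin_num}.
  apply: integrable_ae; first exact: measurable_box.
  apply/integrableP; split; first exact: measurable_funTS.
  rewrite (eq_integral series_sum) ?integral_series_sum_lty // => t _.
  by rewrite gee0_abs.
have := ae_foralln H; apply: filterS => t ht.
pose n := Num.truncn (\sum_(j < d) `|tnth t j : R|).
rewrite -ge0_fin_numE //; apply: (ht n) => j.
have : `|tnth t j : R| < n.+1%:R.
  by apply: le_lt_trans (truncnS_gt _); rewrite (bigD1 j) //= lerDl sumr_ge0.
by rewrite ltr_norml => /andP[/ltW -> ->].
Qed.

(** All terms are nonnegative, so the total sum at t bounds every finite sum at a single scale;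
    hence B0 depends neither on s nor on k. *)
Lemma ae_series_bound : {ae mud, forall t : d.-tuple mR, exists2 B0 : R, 0 <= B0 &
  forall s k, uniq s -> 0 \notin s ->
    \sum_(m <- s) c m * (gam k * cos (pi * dotmz m (row t)) ^+ (2 * nk k)) <= B0}.
Proof.
have := ae_series_sum_lty; apply: filterS => t Gt.
have G0 : (0 <= series_sum t)%E by apply: nneseries_ge0 => i _ _; exact: series_row_ge0.
exists (fine (series_sum t)); first exact: fine_ge0.
move=> s k us s0; rewrite -lee_fin fineK ?ge0_fin_numE //.
have us' : uniq [seq choice.pickle m | m <- s].
  by rewrite map_inj_uniq //; exact: pcan_inj (@choice.pickleK _).
apply: le_trans (seq_le_nneseries (fun i => series_row_ge0 i t) us').
rewrite big_map -sumEFin big_seq [leRHS]big_seq; apply: lee_sum => m ms.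
have m0 : m != 0 by apply: contraNneq s0 => <-.
have h := seq_le_nneseries (fun k => series_term_ge0 (choice.pickle m) k t) (isT : uniq [:: k]).
apply: le_trans h; rewrite big_seq1 /series_term /enum_coef /enum_freq (@pickleK_inv 'rV[int]_d) /= /punctured (negbTE m0).
exact: lexx.
Qed.

End SeriesBound.

Lemma lattice_sum (gamma : R) : (0 < d)%N -> d%:R < 2 * gamma -> exists2 C, 0 <= C &
  forall s, uniq s -> 0 \notin s -> \sum_(m <- s) (1 + enormz R m ^+ 2) `^ (- gamma) <= C.
Proof.
move=> d0 dg; have e0 : 0 < 2 * gamma - d%:R by lra.
have dR : 0 < d%:R :> R by rewrite ltr0n.
pose q : R := (1 - 2 `^ (- (2 * gamma - d%:R)))^-1 * 2 `^ (2 * gamma - d%:R).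
have q0 : 0 <= q.
  rewrite mulr_ge0 ?powR_ge0 // invr_ge0 subr_ge0 powRN invf_le1 ?powR_gt0 //.
  by apply: ltW; exact: powR2_gt1.
exists (4 ^+ d * q); first by rewrite mulr_ge0 // exprn_ge0.
move=> s us s0; have g0 : 0 <= gamma by lra.
have hE t j : uniq t -> 0 \notin t -> (forall m, m \in t -> level m = j) ->
    \sum_(m <- t) (1 : R) <= 4 ^+ d * (2 ^+ j) `^ d%:R.
  by move=> ut t0 tj; apply: le_trans (size_level_le R ut t0 tj); rewrite -sum1_size natr_sum.
have [J] := sum_level_le g0 us s0 (fun _ => ler01) hE.
under eq_bigr do rewrite mulr1.
move=> /le_trans; apply; apply: le_trans (ler_wpM2l (exprn_ge0 d (ler0n R 4)) (geometric_total J e0)).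
rewrite mulr_sumr; apply: ler_sum => j _.
by rewrite opprB addrC powRDp ?exprn_gt0 // le_eqVlt; apply/orP; left; apply/eqP; ring.
Qed.

(** Young's inequality for the conjugate exponents 2/p and 2/(2-p), without its constants: the left
    side is at most one of the two terms, according to whether b <= a^(2-p). *)
Lemma young_powR (a b p : R) : 0 <= a -> 0 <= b -> 0 < p -> p <= 1 ->
  a `^ p * b <= a ^+ 2 + b `^ (2 / (2 - p)).
Proof.
move=> a0 b0 p0 p1; have p2 : 0 < 2 - p by lra.
have [ba|ab] := leP b (a `^ (2 - p)).
  apply: (@le_trans _ _ (a ^+ 2)); last by rewrite lerDl powR_ge0.
  apply: le_trans (ler_wpM2l (powR_ge0 _ _) ba) _.
  rewrite -powRD; last by apply/implyP; rewrite (_ : p + (2 - p) = 2) ?pnatr_eq0 //; ring.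
  by rewrite (_ : p + (2 - p) = 2%:R) ?powR_mulrn //; ring.
have b1 : 0 < b by apply: le_lt_trans ab; exact: powR_ge0.
apply: (@le_trans _ _ (b `^ (2 / (2 - p)))); last by rewrite lerDr sqr_ge0.
have abp : a `^ p <= b `^ (p / (2 - p)).
  rewrite (_ : a `^ p = (a `^ (2 - p)) `^ (p / (2 - p))).
    by apply: powR_le_mono; [exact: powR_ge0 | exact: ltW | rewrite divr_ge0 // ltW].
  by rewrite -powRrM mulrCA mulfV ?mulr1 // gt_eqF.
apply: le_trans (ler_wpM2r b0 abp) _.
rewrite -{2}(powRr1 b0) -powRDp // le_eqVlt; apply/orP; left; apply/eqP.
by congr powR; field; rewrite gt_eqF.
Qed.

(** With w = 1 + |m|^2, Young's inequality for a = w^(delta/2) |f^(m)| and b = w^(-delta p/2) gives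
    a Sobolev term plus w^-gamma, where gamma = delta p/(2-p). The hypothesis on delta says exactly
    that 2 gamma > d. *)
Lemma fourier_coef_powR_sum (p delta : R) (f : 'rV[R]_d -> R[i]) : (0 < d)%N -> 0 < p -> p <= 1 ->
  d%:R / p - d%:R / 2 < delta -> (sobolev_norm delta f < +oo)%E ->
  exists2 B, 0 <= B & forall s, uniq s -> 0 \notin s ->
    \sum_(m <- s) Normc.normc (fourier_coef f m) `^ p <= B.
Proof.
move=> d0 p0 p1 dp nf; have [A A0 [_ hA]] := sobolev_norm_fin nf.
have p2 : 0 < 2 - p by lra.
pose gamma := delta * p / (2 - p).
have dg : d%:R < 2 * gamma.
  rewrite /gamma mulrA ltr_pdivlMr //.
  have : (d%:R / p - d%:R / 2) * p < delta * p by rewrite ltr_pM2r.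
  rewrite mulrBl mulfVK ?gt_eqF //; lra.
have [C C0 hC] := lattice_sum d0 dg.
exists (A + C); first exact: addr_ge0.
move=> s us s0; apply: le_trans (lerD (hA s us) (hC s us s0)).
rewrite -big_split; apply: ler_sum => m _.
set w := 1 + enormz R m ^+ 2; have w0 : 0 < w by rewrite ltr_wpDr ?sqr_ge0.
set n := Normc.normc (fourier_coef f m); have n0 : 0 <= n by rewrite /n; case: (fourier_coef f m) => *; exact: sqrtr_ge0.
have := @young_powR (w `^ (delta / 2) * n) (w `^ (- (delta / 2 * p))) p.
rewrite mulr_ge0 ?powR_ge0 // => /(_ isT isT p0 p1).
rewrite powRM ?powR_ge0 // -powRrM mulrAC -powRDp // subrr powRr0 mul1r.
rewrite exprMn powR_sq (_ : 2 * (delta / 2) = delta); last by field.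
by rewrite -powRrM (_ : - (delta / 2 * p) * (2 / (2 - p)) = - gamma) // /gamma; field; rewrite gt_eqF.
Qed.

Lemma Phi0_le_powR n (x : R) : 0 < x -> x <= n.+1%:R -> Phi R n 0 <= x `^ (- 2^-1).
Proof.
move=> x0 xn; apply: (@le_trans _ _ (n.+1%:R `^ (- 2^-1))); last first.
  by apply: powR_le_anti => //; rewrite invr_ge0.
rewrite -(@ler_pXn2r _ 2) ?nnegrE ?powR_ge0 ?(ltW (Phi0_gt0 R n)) // powR_sq.
rewrite mulrN divff // powR_inv1 // -[leRHS]mul1r ler_pdivlMr //.
by have := sqr_Phi0_le R n; rewrite -(natr1 n).
Qed.

(** For theta >= 1 the conditions are d/(delta + d/2) < p < 1/theta, a nonempty interval whose
    midpoint is taken; for theta < 1, p = 1 works. *)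
Lemma exists_exponent (delta theta : R) : (0 < d)%N -> 0 < theta ->
  (theta < 1 -> d%:R / 2 < delta) -> (1 <= theta -> d%:R * theta - d%:R / 2 < delta) ->
  exists p : R, [/\ 0 < p, p <= 1, theta * p < 1 & d%:R / p - d%:R / 2 < delta].
Proof.
move=> d0 th h1 h2; have dR : 0 < d%:R :> R by rewrite ltr0n.
have [t1|t1] := ltP theta 1.
  by exists 1; split=> //; [rewrite mulr1 | have := h1 t1; lra].
have {}h2 := h2 t1; have e0 : 0 < delta + d%:R / 2.
  have : 0 < d%:R * theta by rewrite mulr_gt0.
  lra.
have pq : d%:R / (delta + d%:R / 2) < theta^-1.
  by rewrite ltr_pdivrMr // mulrC ltr_pdivlMr //; lra.
pose p := (d%:R / (delta + d%:R / 2) + theta^-1) / 2.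
have i0 : 0 < theta^-1 by rewrite invr_gt0.
have q0 : 0 < d%:R / (delta + d%:R / 2) by rewrite divr_gt0.
have p0 : 0 < p by rewrite /p; lra.
have pt : p < theta^-1 by rewrite /p; lra.
exists p; split=> //.
- by apply: le_trans (ltW pt) _; rewrite invf_le1.
- by rewrite mulrC -ltr_pdivlMr // mul1r.
- suff : d%:R / p < delta + d%:R / 2 by lra.
  by rewrite ltr_pdivrMr // mulrC -ltr_pdivrMr // /p; lra.
Qed.

(* Only dyadic N matter, and the p-th powers of the terms have a summable integral:
   the mean of cos^(2n)(pi m.alpha) over integer boxes is the central value Phi n 0 ~ n^(-1/2). *)
Theorem discrepancy_ae (delta theta : R) (f : 'rV[R]_d -> R[i]) : (0 < d)%N -> 0 < theta ->
  (theta < 1 -> d%:R / 2 < delta) -> (1 <= theta -> d%:R * theta - d%:R / 2 < delta) ->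
  sobolev delta f ->
  {ae mud, forall a : d.-tuple mR, exists2 c : R, 0 < c & forall N : nat, (0 < N)%N ->
     (sup_norm (discrepancy (@Phi R) N (row a) f) <= (c * N%:R `^ (- (theta / 2)))%:E)%E}.
Proof.
move=> d0 th h1 h2 [cf pf nf].
have [p [p0 p1 tp dp]] := exists_exponent d0 th h1 h2.
have [B B_ge0 hB] := fourier_coef_powR_sum d0 p0 p1 dp nf.
pose c m := Normc.normc (fourier_coef f m) `^ p.
pose gam k : R := (2 ^+ k) `^ (theta / 2 * p).
(* The p-th power of cos^(2 2^k) would have exponent 2^(k+1) p, in general not an integer. Rounding
   2^k p down only increases the power, as cos^2 <= 1. *)
pose nk k := Num.truncn (2 ^+ k * p).
have nkP k : (nk k)%:R <= 2 ^+ k * p < (nk k).+1%:R.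
  by rewrite truncn_le truncnS_gt mulr_ge0 ?exprn_ge0 // ltW.
have e0 : 0 < (1 - theta * p) / 2 by rewrite divr_gt0 // subr_gt0.
pose B' := p `^ (- 2^-1) * ((1 - 2 `^ (- ((1 - theta * p) / 2)))^-1 * 2 `^ ((1 - theta * p) / 2)).
have gam_sum K : \sum_(0 <= k < K) gam k * Phi R (nk k) 0 <= B'.
  apply: le_trans (ler_wpM2l (powR_ge0 p _) (geometric_total K e0)).
  rewrite big_mkord mulr_sumr; apply: ler_sum => k _.
  have k0 : 0 < (2 : R) ^+ k by rewrite exprn_gt0.
  apply: (@le_trans _ _ (gam k * (2 ^+ k * p) `^ (- 2^-1))).
    apply: ler_wpM2l; first exact: powR_ge0.
    by apply: Phi0_le_powR; [rewrite mulr_gt0 | have /andP[_ /ltW] := nkP k].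
  rewrite powRM ?(ltW k0) ?(ltW p0) // mulrA -powRDp // mulrC le_eqVlt; apply/orP; left; apply/eqP.
  by congr (_ * _ `^ _); field.
have := ae_series_bound (c := c) (gam := gam) (nk := nk)
  (fun m => powR_ge0 _ _) (fun k => powR_ge0 _ _) hB gam_sum.
apply: filterS => a [B0 B00 hB0].
(* The return from p-th powers: every b m is at most B0, so (b m)^(1/p) <= b m (B0 + 1)^(1/p - 1),
   and the sum of the b m is at most B0. *)
pose D := B0 * (B0 + 1) `^ (p^-1 - 1).
have D0 : 0 <= D by rewrite mulr_ge0 ?powR_ge0.
exists (2 `^ (theta / 2) * D + 1); first by rewrite ltr_wpDl // mulr_ge0 ?powR_ge0.
move=> N N0; apply: sup_norm_le => x; apply: discrepancy_le => // s us s0.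
pose k := trunc_log 2 N.
have /andP[kN Nk] : (2 ^ k <= N < 2 ^ k.+1)%N by exact: trunc_log_bounds.
have k0 : 0 < (2 : R) ^+ k by rewrite exprn_gt0.
pose b m := c m * (gam k * cos (pi * dotmz m (row a)) ^+ (2 * nk k)).
have b0 m : 0 <= b m by rewrite !mulr_ge0 ?powR_ge0 ?cos_pow_ge0.
have bB m : m \in s -> b m <= B0.
  move=> ms; have := hB0 [:: m] k isT; rewrite big_seq1; apply.
  by rewrite inE; apply: contraNneq s0 => ->.
have term m : m \in s -> Normc.normc (fourier_coef f m) * cos (pi * dotmz m (row a)) ^+ (2 * N) <=
    (2 ^+ k) `^ (- (theta / 2)) * (b m * (B0 + 1) `^ (p^-1 - 1)).
  move=> ms; set n := Normc.normc (fourier_coef f m); pose u := cos (pi * dotmz m (row a)) ^+ 2.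
  have n0 : 0 <= n by rewrite /n; case: (fourier_coef f m) => *; exact: sqrtr_ge0.
  have u0 : 0 <= u by exact: sqr_ge0.
  have u1 : u <= 1 by rewrite -(cos2Dsin2 (pi * dotmz m (row a))) lerDl sqr_ge0.
  pose y := n * ((2 ^+ k) `^ (theta / 2) * u ^+ (2 ^ k)).
  have uX j : 0 <= u ^+ j by exact: exprn_ge0.
  have v0 : 0 <= (2 ^+ k) `^ (theta / 2) * u ^+ (2 ^ k).
    by apply: mulr_ge0 => //; exact: powR_ge0.
  have y0 : 0 <= y by exact: mulr_ge0.
  have yb : y `^ p <= b m.
    have -> : y `^ p = n `^ p * ((2 ^+ k) `^ (theta / 2) `^ p * (u ^+ (2 ^ k)) `^ p).
      by rewrite /y powRM // powRM // powR_ge0.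
    rewrite /b /c -/n /gam exprM -/u -powRrM.
    rewrite ler_wpM2l ?powR_ge0 // ler_wpM2l ?powR_ge0 //.
    have [->|un0] := eqVneq u 0.
      by rewrite expr0n expn_eq0 /= powR0 ?gt_eqF // exprn_ge0.
    have up : 0 < u by rewrite lt0r un0.
    rewrite -!powR_mulrn // -powRrM natrX; apply: ger_powR; first by rewrite up.
    by case/andP: (nkP k).
  have yb' : y <= b m * (B0 + 1) `^ (p^-1 - 1).
    have -> : y = (y `^ p) `^ p^-1 by rewrite -powRrM mulfV ?gt_eqF // powRr1.
    apply: (@le_trans _ _ (b m `^ p^-1)).
      by apply: powR_le_mono; rewrite ?powR_ge0 // invr_ge0 ltW.
    rewrite -mulr_powRB1 ?invr_gt0 // ler_wpM2l //; apply: powR_le_mono => //.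
      by apply: le_trans (bB _ ms) _; rewrite lerDl.
    by rewrite subr_ge0 invf_ge1.
  apply: le_trans (ler_wpM2l (powR_ge0 _ _) yb').
  rewrite /y mulrCA; apply: ler_wpM2l => //.
  rewrite mulrA -powRDp // addNr powRr0 mul1r exprM -/u.
  exact: ler_wiXn2l.
apply: (@le_trans _ _ (\sum_(m <- s) (2 ^+ k) `^ (- (theta / 2)) * (b m * (B0 + 1) `^ (p^-1 - 1)))).
  by rewrite big_seq [leRHS]big_seq; apply: ler_sum.
rewrite -mulr_sumr -mulr_suml.
apply: (@le_trans _ _ ((2 ^+ k) `^ (- (theta / 2)) * D)).
  by rewrite ler_wpM2l ?powR_ge0 // ler_wpM2r ?powR_ge0 // hB0.
have N0' : 0 < N%:R :> R by rewrite ltr0n.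
(* From the dyadic scale back to N: N/2 < 2^k costs the factor 2^(theta/2). *)
apply: (@le_trans _ _ (2 `^ (theta / 2) * N%:R `^ (- (theta / 2)) * D)).
  have -> : (2 : R) `^ (theta / 2) = 2^-1 `^ (- (theta / 2)).
    by rewrite -powR_inv1 // -powRrM mulN1r opprK.
  rewrite ler_wpM2r // -powRM ?invr_ge0 ?(ltW N0') //; apply: powR_le_anti.
  - by rewrite mulr_gt0 ?invr_gt0.
  - rewrite ler_pdivrMl // -exprS -natrX ler_nat; exact: ltnW.
  - by rewrite divr_ge0 // ltW.
by rewrite mulrAC ler_wpM2r ?powR_ge0 // lerDl.
Qed.

End PartA.

Theorem corollary1p10 (R : realType) (d : nat) (hd : (0 < d)%N)
    (theta : R) (htheta : 0 < theta) :
  [/\ exists2 K : R, 0 < K &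
        forall (N : nat) (t : R), (0 < N)%N ->
          ComplexField.Normc.normc (kernel_transform (@Phi R) N t) <=
          K * (1 + (isqrt R N)%:R * dist_int t) `^ (- theta),
      forall (delta : R) (f : 'rV[R]_d -> R[i]),
        (theta < 1 -> d%:R / 2 < delta) ->
        (1 <= theta -> d%:R * theta - d%:R / 2 < delta) ->
        sobolev delta f ->
        {ae lebesgue_tuple R d, forall a : d.-tuple (measurableTypeR R),
          exists2 c : R, 0 < c &
            forall N : nat, (0 < N)%N ->
              (sup_norm (discrepancy (@Phi R) N (row_of_tuple a) f) <=
               (c * N%:R `^ (- (theta / 2)))%:E)%E}
    & forall (alpha : 'rV[R]_d) (H sigma delta : R),
        irrational_vec alpha ->
        0 < H -> d%:R <= sigma ->
        (forall m : 'rV[int]_d, m != 0 ->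
           H * enormz R m `^ (- sigma) <= dist_int (dotmz m alpha)) ->
        d%:R / 2 < delta ->
        exists2 c : R, 0 < c &
          forall (f : 'rV[R]_d -> R[i]) (N : nat), sobolev delta f -> (0 < N)%N ->
            (sup_norm (discrepancy (@Phi R) N alpha f) <=
             (c * N%:R `^ (- (theta / 2)) *
              X d delta theta sigma (isqrt R N))%:E * sobolev_norm delta f)%E].
Proof.
split=> [|delta f|alpha H sigma delta _].
- exists (expR (theta ^+ 2 / 4)); first exact: expR_gt0.
  move=> N t N0; rewrite kernel_Phi normc_real ger0_norm ?cos_pow_ge0 //.
  exact: cos_pow_le.
- exact: discrepancy_ae.
- exact: discrepancy_diophantine.
Qed.
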